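(* Let $k$ be a commutative Noetherian ring, and suppose that $\mathcal{C}$ has a generic shift functor $S$. If $\operatorname{reg}(S M(s)) \leqslant s$ for all $s \geqslant 0$, then $\operatorname{reg}(V) < \infty$ for every finitely generated $\mathcal{C}$-module $V$.
   Context: Let $k$ be a commutative ring with identity. $\mathcal{C}$ denotes a category whose objects are the nonnegative integers, which is $k$-linear (enriched over $k$-modules), locally finite (each $\mathcal{C}(r,s)$ is a finitely generated $k$-module) and directed ($\mathcal{C}(r,s)=0$ whenever $r>s$). A $\mathcal{C}$-module $V$ is a covariant $k$-linear functor from $\mathcal{C}$ to $k$-modules; write $V_s=V(s)$. It is finitely generated if it contains a finite set of elements (of the various $V_s$) contained in no proper submodule. For $s\geqslant 0$, $M(s)=\mathcal{C}(s,-)$ is the representable (projective) $\mathcal{C}$-module. $V$ is generated in degrees $\leqslant s$ if the only submodule of $V$ containing $V_r$ for all $r\leqslant s$ is $V$; $V$ is generated in degrees $\leqslant -1$ if $V=0$. A self-embedding functor of degree 1 is a faithful ($k$-linear) functor $\iota:\mathcal{C}\to\mathcal{C}$ with $\iota(s)=s+1$ for all $s\geqslant 0$. A shift functor is the pull-back functor $S=\iota^*$ on the category of all $\mathcal{C}$-modules, $SV=V\circ\iota$ (so $(SV)_s=V_{s+1}$), for such an $\iota$. A shift functor $S$ is generic if there is a natural transformation $\mu:\mathrm{Id}\to S$ such that for every $s\geqslant 0$ the map $\mu_{M(s)}:M(s)\to SM(s)$ is injective and its cokernel is generated in degrees $\leqslant s-1$. Homology: view $\mathcal{C}$ as the $k$-algebra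 $\bigoplus_{r\leqslant s}\mathcal{C}(r,s)$, a $\mathcal{C}$-module $V$ as $\bigoplus_s V_s$, and let $\mathfrak{m}=\bigoplus_{r<s}\mathcal{C}(r,s)$, a two-sided ideal. Put $H_0(V)=V/\mathfrak{m}V\cong\mathcal{C}/\mathfrak{m}\otimes_{\mathcal{C}}V$ and let $H_i(V)=\operatorname{Tor}_i^{\mathcal{C}}(\mathcal{C}/\mathfrak{m},V)$ be its $i$-th left derived functor; these are $\mathcal{C}$-modules. The $i$-th homological degree is $\operatorname{hd}_i(V)=\sup\{s\geqslant 0\mid (H_i(V))_s\neq 0\}$ (possibly $\infty$), set to be $-1$ if this set is empty. The Castelnuovo-Mumford regularity is $\operatorname{reg}(V)=\sup\{\operatorname{hd}_i(V)-i\mid i\geqslant 0\}$. *)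

(* Defs.v *)
From HB Require Import structures.
From mathcomp Require Import all_boot all_order all_algebra.
From mathcomp Require Import finmap.
From mathcomp Require Import mathcomp_extra boolp classical_sets functions.
From mathcomp Require Import cardinality fsbigop constructive_ereal.

Set Implicit Arguments.
Unset Strict Implicit.
Unset Printing Implicit Defensive.

Import Order.TTheory GRing.Theory Num.Theory.
Local Open Scope classical_set_scope.
Local Open Scope ring_scope.
Local Open Scope quotient_scope.

(** * Modules over the ground ring *)

(* The rings are commutative with identity; the zero ring is not excluded. *)
Definition noetherian (k : comPzRingType) : Prop :=
  forall I : {pred k}, submod_closed (I : {pred k^o}) ->
  exists (n : nat) (x : 'I_n -> k), (forall i, x i \in I) /\
    forall a, a \in I -> exists c : 'I_n -> k, a = \sum_(i < n) c i * x i.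

Definition fg_lmod (k : comPzRingType) (W : lmodType k) : Prop :=
  exists (n : nat) (x : 'I_n -> W),
    forall w, exists c : 'I_n -> k, w = \sum_(i < n) c i *: x i.

Section SubLmodule.
Variables (k : comPzRingType) (W : lmodType k).
Variables (N : {pred W}) (subN : submod_closed N).

(* [N] carrying the proof that it is a submodule, so that the instances below
   can be found by unification. *)
Definition submod_pred of submod_closed N : {pred W} := N.
Local Notation P := (submod_pred subN).

Fact submod_pred_submod : submod_closed P. Proof. exact: subN. Qed.
HB.instance Definition _ := GRing.isSubmodClosed.Build k W P submod_pred_submod.

Definition sub_lmod : Type := {x : W | x \in P}.
HB.instance Definition _ := SubChoice.on sub_lmod.
HB.instance Definition _ := [SubChoice_isSubLmodule of sub_lmod by <:].

End SubLmodule.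

Section QuotientLmodule.
Variables (k : comPzRingType) (W : lmodType k).
Variables (N : {pred W}) (subN : submod_closed N).

Local Notation P := (submod_pred subN).

Definition quot_lmod : Type := Quotient.quot P.
HB.instance Definition _ := GRing.Zmodule.on quot_lmod.

Definition quot_pi (x : W) : quot_lmod := \pi_(Quotient.quot P) x.
Definition quot_repr (x : quot_lmod) : W := repr (x : Quotient.quot P).

Lemma quot_reprK : cancel quot_repr quot_pi.
Proof. by move=> x; rewrite /quot_pi /quot_repr reprK. Qed.

Lemma quot_pi_eq x y : (quot_pi x = quot_pi y) <-> (x - y \in N).
Proof.
by split=> [/eqP e|h]; [|apply/eqP];
   move: (Quotient.idealrBE P x y); rewrite -/(quot_pi x) ?e ?h // => <-.
Qed.

Lemma quot_piD x y : quot_pi (x + y) = quot_pi x + quot_pi y.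
Proof. exact: (Quotient.pi_add P). Qed.

Lemma quot_reprB x : quot_repr (quot_pi x) - x \in N.
Proof. by apply/quot_pi_eq; rewrite quot_reprK. Qed.

Definition quot_scale (a : k) (x : quot_lmod) : quot_lmod :=
  quot_pi (a *: quot_repr x).

Lemma quot_piZ a x : quot_scale a (quot_pi x) = quot_pi (a *: x).
Proof.
apply/quot_pi_eq; rewrite -scalerBr.
exact: (GRing.subsemimod_closedZ (GRing.submod_closed_semi subN)) (quot_reprB x).
Qed.

Fact quot_scaleA a b x :
  quot_scale a (quot_scale b x) = quot_scale (a * b) x.
Proof. by rewrite -[x]quot_reprK !quot_piZ scalerA. Qed.
Fact quot_scale1 : left_id 1 quot_scale.
Proof. by move=> x; rewrite -[x]quot_reprK quot_piZ scale1r. Qed.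
Fact quot_scaleDr : right_distributive quot_scale +%R.
Proof.
move=> a x y; rewrite -[x]quot_reprK -[y]quot_reprK -quot_piD !quot_piZ.
by rewrite scalerDr quot_piD.
Qed.
Fact quot_scaleDl x : {morph quot_scale^~ x : a b / a + b}.
Proof. by move=> a b; rewrite -[x]quot_reprK !quot_piZ scalerDl quot_piD. Qed.

HB.instance Definition _ := GRing.Zmodule_isLmodule.Build k quot_lmod
  quot_scaleA quot_scale1 quot_scaleDr quot_scaleDl.

Fact quot_pi_linear : linear quot_pi.
Proof. by move=> a x y; rewrite quot_piD -quot_piZ. Qed.
HB.instance Definition _ :=
  GRing.isLinear.Build k W quot_lmod *:%R quot_pi quot_pi_linear.

Lemma quot_pi_eq0 x : (quot_pi x = 0) <-> (x \in N).
Proof. by rewrite -[0](linear0 quot_pi) quot_pi_eq subr0. Qed.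

End QuotientLmodule.

Section QuotientMap.
Variables (k : comPzRingType) (W W' : lmodType k).
Variables (N : {pred W}) (N' : {pred W'}).
Variables (subN : submod_closed N) (subN' : submod_closed N').

Definition quot_map (f : W -> W') (x : quot_lmod subN) : quot_lmod subN' :=
  quot_pi subN' (f (quot_repr x)).

Hypotheses (f : {linear W -> W'}) (fN : forall x, x \in N -> f x \in N').

Lemma quot_mapE x : quot_map f (quot_pi subN x) = quot_pi subN' (f x).
Proof.
by apply/quot_pi_eq; rewrite -linearB; apply: fN; exact: quot_reprB.
Qed.

Lemma quot_map_linear : linear (quot_map f).
Proof.
move=> a x y; rewrite -[x]quot_reprK -[y]quot_reprK.
by rewrite -linearP !quot_mapE !linearP.
Qed.

End QuotientMap.

(** * Finitely supported families *)

Section DirectSum.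
Variables (k : comPzRingType) (I : choiceType) (W : I -> lmodType k).

Record dsum : Type := Dsum {
  dsum_val :> forall i, W i;
  dsum_supp : finite_set [set i | dsum_val i != 0] }.

HB.instance Definition _ := gen_eqMixin dsum.
HB.instance Definition _ := gen_choiceMixin dsum.

Lemma dsumP (x y : dsum) : (forall i, x i = y i) -> x = y.
Proof.
case: x y => [x hx] [y hy] /= e.
have {}e : x = y by exact: functional_extensionality_dep.
by subst y; congr Dsum; exact: Prop_irrelevance.
Qed.

Fact dsum_supp0 : finite_set [set i | (0 : W i) != 0].
Proof. by apply: sub_finite_set (finite_set0 I) => i /=; rewrite eqxx. Qed.
Definition dsum0 := Dsum dsum_supp0.

Fact dsum_suppP (x y : dsum) (a : k) :
  finite_set [set i | a *: x i + y i != 0].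
Proof.
have h : finite_set ([set i | x i != 0] `|` [set i | y i != 0]).
  by rewrite finite_setU; split; exact: dsum_supp.
apply: sub_finite_set h => i /=; case: (eqVneq (x i) 0) => [->|_ _]; last by left.
by rewrite scaler0 add0r; right.
Qed.
Definition dsum_lin a x y := Dsum (dsum_suppP x y a).

Definition dsum_add x y := dsum_lin 1 x y.
Definition dsum_opp x := dsum_lin (-1) x dsum0.
Definition dsum_scale a x := dsum_lin a x dsum0.

Fact dsum_addA : associative dsum_add.
Proof. by move=> x y z; apply: dsumP => i /=; rewrite !scale1r addrA. Qed.
Fact dsum_addC : commutative dsum_add.
Proof. by move=> x y; apply: dsumP => i /=; rewrite !scale1r addrC. Qed.
Fact dsum_add0 : left_id dsum0 dsum_add.
Proof. by move=> x; apply: dsumP => i /=; rewrite scale1r add0r. Qed.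
Fact dsum_addN : left_inverse dsum0 dsum_opp dsum_add.
Proof.
by move=> x; apply: dsumP => i /=; rewrite scale1r addr0 scaleN1r addNr.
Qed.
HB.instance Definition _ :=
  GRing.isZmodule.Build dsum dsum_addA dsum_addC dsum_add0 dsum_addN.

Fact dsum_scaleA a b x : dsum_scale a (dsum_scale b x) = dsum_scale (a * b) x.
Proof. by apply: dsumP => i /=; rewrite !addr0 scalerA. Qed.
Fact dsum_scale1 : left_id 1 dsum_scale.
Proof. by move=> x; apply: dsumP => i /=; rewrite addr0 scale1r. Qed.
Fact dsum_scaleDr : right_distributive dsum_scale +%R.
Proof.
by move=> a x y; apply: dsumP => i /=; rewrite !addr0 !scale1r scalerDr.
Qed.
Fact dsum_scaleDl x : {morph dsum_scale^~ x : a b / a + b}.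
Proof. by move=> a b; apply: dsumP => i /=; rewrite !addr0 scale1r scalerDl. Qed.
HB.instance Definition _ := GRing.Zmodule_isLmodule.Build k dsum
  dsum_scaleA dsum_scale1 dsum_scaleDr dsum_scaleDl.

Lemma dsumE a (x y : dsum) i : (a *: x + y) i = a *: x i + y i.
Proof. by rewrite /= scale1r addr0. Qed.

End DirectSum.

(** * Categories and their modules *)

Section LinearCategories.
Variable k : comPzRingType.

Record lincat := LinCat {
  hom : nat -> nat -> lmodType k;
  idm : forall s, hom s s;
  mcomp : forall r s t, hom s t -> hom r s -> hom r t;
  comp_linearl : forall r s t (f : hom r s), linear (fun g : hom s t => mcomp g f);
  comp_linearr : forall r s t (g : hom s t), linear (fun f : hom r s => mcomp g f);
  comp_idl : forall r s (f : hom r s), mcomp (idm s) f = f;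
  comp_idr : forall r s (f : hom r s), mcomp f (idm r) = f;
  comp_assoc : forall r s t u (h : hom t u) (g : hom s t) (f : hom r s),
    mcomp h (mcomp g f) = mcomp (mcomp h g) f;
  hom_fg : forall r s, fg_lmod (hom r s);
  hom_directed : forall r s, (s < r)%N -> forall f : hom r s, f = 0 }.

Variable C : lincat.

Record cmod := CMod {
  cmod_val :> nat -> lmodType k;
  act : forall r s, hom C r s -> cmod_val r -> cmod_val s;
  act_linearl : forall r s (v : cmod_val r),
    linear (fun f : hom C r s => act f v);
  act_linearr : forall r s (f : hom C r s), linear (act f);
  act_id : forall s (v : cmod_val s), act (idm C s) v = v;
  act_comp : forall r s t (g : hom C s t) (f : hom C r s) (v : cmod_val r),
    act (mcomp g f) v = act g (act f v) }.

HB.instance Definition _ (V : cmod) r s (f : hom C r s) :=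
  GRing.isLinear.Build k (V r) (V s) *:%R (@act V r s f) (@act_linearr V r s f).

Lemma act0l (V : cmod) r s (v : V r) : act (0 : hom C r s) v = 0.
Proof.
have := act_linearl v (-1) (0 : hom C r s) 0.
by rewrite scaler0 addr0 scaleN1r addNr.
Qed.

Record chom (V W : cmod) := CHom {
  chom_val :> forall s, V s -> W s;
  chom_linear : forall s, linear (@chom_val s);
  chom_act : forall r s (f : hom C r s) (v : V r),
    chom_val (act f v) = act f (chom_val v) }.
Arguments chom_val {V W} _ s _.

HB.instance Definition _ (V W : cmod) (f : chom V W) s :=
  GRing.isLinear.Build k (V s) (W s) *:%R (f s) (@chom_linear V W f s).

Record submod (V : cmod) := SubMod {
  submod_val :> forall s, {pred V s};
  submodP : forall s, submod_closed (@submod_val s);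
  submod_act : forall r s (f : hom C r s) (v : V r),
    v \in @submod_val r -> act f v \in @submod_val s }.
Arguments submod_val {V} _ s _.

Definition full_submod (V : cmod) (N : submod V) : Prop :=
  forall s (v : V s), v \in N s.

Definition fin_gen (V : cmod) : Prop :=
  exists (n : nat) (d : 'I_n -> nat) (x : forall i, V (d i)),
    forall N : submod V, (forall i, x i \in N (d i)) -> full_submod N.

(* The degree is an integer, in order to allow [-1]. *)
Definition gen_in_degrees_le (V : cmod) (d : int) : Prop :=
  forall N : submod V,
    (forall r, r%:Z <= d -> forall v : V r, v \in N r) -> full_submod N.

Definition representable (s : nat) : cmod :=
  @CMod (hom C s) (@mcomp C s)
    (fun r t f => @comp_linearl C s r t f)
    (fun r t f => @comp_linearr C s r t f)
    (fun r f => @comp_idl C s r f)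
    (fun r t u g f v => esym (comp_assoc g f v)).

(** ** Submodules and quotients as modules *)

Section SubCmod.
Variables (V : cmod) (N : submod V).

Definition subc_val (s : nat) : lmodType k := sub_lmod (submodP N s).

Definition subc_act r s (f : hom C r s) (x : subc_val r) : subc_val s :=
  exist _ (act f (val x)) (submod_act f (valP x)).

Fact subc_linearl r s (x : subc_val r) :
  linear (fun f : hom C r s => subc_act f x).
Proof. by move=> a f g; apply: val_inj; exact: act_linearl. Qed.
Fact subc_linearr r s (f : hom C r s) : linear (subc_act f).
Proof. by move=> a x y; apply: val_inj; rewrite /= linearP. Qed.
Fact subc_id s (x : subc_val s) : subc_act (idm C s) x = x.
Proof. by apply: val_inj; exact: act_id. Qed.
Fact subc_comp r s t (g : hom C s t) (f : hom C r s) (x : subc_val r) :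
  subc_act (mcomp g f) x = subc_act g (subc_act f x).
Proof. by apply: val_inj; exact: act_comp. Qed.

Definition sub_cmod : cmod := CMod subc_linearl subc_linearr subc_id subc_comp.

Fact sub_incl_linear s : linear (fun x : sub_cmod s => val x : V s).
Proof. by []. Qed.
Fact sub_incl_act r s (f : hom C r s) (x : sub_cmod r) :
  val (act f x) = act f (val x) :> V s.
Proof. by []. Qed.
Definition sub_incl : chom sub_cmod V := CHom sub_incl_linear sub_incl_act.

End SubCmod.

Section QuotCmod.
Variables (V : cmod) (N : submod V).

Definition quotc_val (s : nat) : lmodType k := quot_lmod (submodP N s).

Definition quotc_act r s (f : hom C r s) : quotc_val r -> quotc_val s :=
  quot_map _ (act f).

Lemma quotc_actE r s (f : hom C r s) v :
  quotc_act f (quot_pi (submodP N r) v) = quot_pi (submodP N s) (act f v).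
Proof. by apply: quot_mapE => x; exact: submod_act. Qed.

Fact quotc_linearl r s (x : quotc_val r) :
  linear (fun f : hom C r s => quotc_act f x).
Proof.
move=> a f g; rewrite -[x]quot_reprK !quotc_actE -linearP; congr quot_pi.
exact: act_linearl.
Qed.
Fact quotc_linearr r s (f : hom C r s) : linear (quotc_act f).
Proof. by apply: quot_map_linear => x; exact: submod_act. Qed.
Fact quotc_id s (x : quotc_val s) : quotc_act (idm C s) x = x.
Proof. by rewrite -[x]quot_reprK quotc_actE act_id. Qed.
Fact quotc_comp r s t (g : hom C s t) (f : hom C r s) (x : quotc_val r) :
  quotc_act (mcomp g f) x = quotc_act g (quotc_act f x).
Proof. by rewrite -[x]quot_reprK !quotc_actE act_comp. Qed.

Definition quot_cmod : cmod :=
  CMod quotc_linearl quotc_linearr quotc_id quotc_comp.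

Fact quot_proj_act r s (f : hom C r s) (v : V r) :
  quot_pi (submodP N s) (act f v) = act f (quot_pi (submodP N r) v : quot_cmod r).
Proof. by rewrite /= quotc_actE. Qed.
Definition quot_proj : chom V quot_cmod :=
  @CHom V quot_cmod (fun s => quot_pi (submodP N s))
    (fun s => @quot_pi_linear _ _ _ (submodP N s)) quot_proj_act.

End QuotCmod.

Section KernelImage.
Variables (V W : cmod) (f : chom V W).

Fact ker_submod_closed s : submod_closed [pred v : V s | f s v == 0].
Proof.
split=> [|a u v]; rewrite !inE ?linear0 // => /eqP fu /eqP fv.
by rewrite linearP /= fu fv scaler0 addr0.
Qed.
Fact ker_submod_act r s (g : hom C r s) (v : V r) :
  v \in [pred v : V r | f r v == 0] -> act g v \in [pred v : V s | f s v == 0].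
Proof. by rewrite !inE chom_act => /eqP ->; rewrite linear0. Qed.
Definition ker_submod : submod V := SubMod ker_submod_closed ker_submod_act.

Fact im_submod_closed s :
  submod_closed [pred w : W s | `[< exists v, f s v = w >]].
Proof.
split=> [|a _ _ /asboolP[u <-] /asboolP[v <-]]; apply/asboolP.
  by exists 0; rewrite linear0.
by exists (a *: u + v); rewrite linearP.
Qed.
Fact im_submod_act r s (g : hom C r s) (w : W r) :
  w \in [pred w : W r | `[< exists v, f r v = w >]] ->
  act g w \in [pred w : W s | `[< exists v, f s v = w >]].
Proof. by move=> /asboolP[v <-]; apply/asboolP; exists (act g v); rewrite chom_act. Qed.
Definition im_submod : submod W := SubMod im_submod_closed im_submod_act.

Definition coker : cmod := quot_cmod im_submod.

End KernelImage.

Section PreimageSubmod.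
Variables (V W : cmod) (f : chom V W) (N : submod W).

Fact preim_submod_closed s : submod_closed [pred v : V s | f s v \in N s].
Proof.
have [N0 Nlin] := submodP N s.
split=> [|a u v]; rewrite !inE ?linear0 // => fu fv.
by rewrite linearP; exact: Nlin.
Qed.
Fact preim_submod_act r s (g : hom C r s) (v : V r) :
  v \in [pred v : V r | f r v \in N r] ->
  act g v \in [pred v : V s | f s v \in N s].
Proof. by rewrite !inE chom_act; exact: submod_act. Qed.
Definition preim_submod : submod V :=
  SubMod preim_submod_closed preim_submod_act.

End PreimageSubmod.

Fact comp_chom_linear (U V W : cmod) (g : chom V W) (f : chom U V) s :
  linear (fun u : U s => g s (f s u)).
Proof. by move=> a u v; rewrite !linearP. Qed.
Fact comp_chom_act (U V W : cmod) (g : chom V W) (f : chom U V)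
  r s (h : hom C r s) (u : U r) : g s (f s (act h u)) = act h (g r (f r u)).
Proof. by rewrite !chom_act. Qed.
Definition comp_chom (U V W : cmod) (g : chom V W) (f : chom U V) : chom U W :=
  CHom (comp_chom_linear g f) (comp_chom_act g f).

(* [Ker g / (Ker g :&: Im f)]: the homology at [V], when [g \o f = 0] *)
Definition homology (U V W : cmod) (f : chom U V) (g : chom V W) : cmod :=
  quot_cmod (preim_submod (sub_incl (ker_submod g)) (im_submod f)).

(** ** Shift functors *)

Record self_embedding := SelfEmbedding {
  emb :> forall r s, hom C r s -> hom C r.+1 s.+1;
  emb_linear : forall r s, linear (@emb r s);
  emb_id : forall s, emb (idm C s) = idm C s.+1;
  emb_comp : forall r s t (g : hom C s t) (f : hom C r s),
    emb (mcomp g f) = mcomp (emb g) (emb f);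
  emb_faithful : forall r s, injective (@emb r s) }.
Arguments emb _ {r s} _.

Section Shift.
Variable iota : self_embedding.

Section ShiftObject.
Variable V : cmod.

Fact shift_linearl r s (v : V r.+1) :
  linear (fun f : hom C r s => act (emb iota f) v).
Proof. by move=> a f g; rewrite emb_linear act_linearl. Qed.
Fact shift_linearr r s (f : hom C r s) : linear (@act V _ _ (emb iota f)).
Proof. exact: act_linearr. Qed.
Fact shift_id s (v : V s.+1) : act (emb iota (idm C s)) v = v.
Proof. by rewrite emb_id act_id. Qed.
Fact shift_comp r s t (g : hom C s t) (f : hom C r s) (v : V r.+1) :
  act (emb iota (mcomp g f)) v = act (emb iota g) (act (emb iota f) v).
Proof. by rewrite emb_comp act_comp. Qed.

Definition shift : cmod :=
  @CMod (fun s => V s.+1) (fun r s f => act (emb iota f))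
    shift_linearl shift_linearr shift_id shift_comp.

End ShiftObject.

Definition shift_map (V W : cmod) (f : chom V W) : chom (shift V) (shift W) :=
  @CHom (shift V) (shift W) (fun s => f s.+1) (fun s => @chom_linear V W f s.+1)
    (fun r s g v => chom_act f (emb iota g) v).

Definition natural_to_shift (mu : forall V, chom V (shift V)) : Prop :=
  forall (V W : cmod) (f : chom V W) s (v : V s),
    mu W s (f s v) = shift_map f s (mu V s v).

Definition generic_shift : Prop :=
  exists mu : forall V, chom V (shift V), natural_to_shift mu /\
    forall s : nat, (forall t, injective (mu (representable s) t)) /\
      gen_in_degrees_le (coker (mu (representable s))) (s%:Z - 1).

End Shift.

(** ** The functor [V |-> V / mV] *)

Section H0.
Variable V : cmod.

(* [m] is spanned by the morphisms between distinct objects; a finite sum of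
   elements [f v] with [f] in [m] is given by a list of triples [(r, (f, v))]. *)
Definition mV_pred s : {pred V s} :=
  [pred x | `[< exists l : seq {r : nat & (hom C r s * V r)%type},
    x = \sum_(t <- l | (tag t < s)%N) act (tagged t).1 (tagged t).2 >]].
Arguments mV_pred : clear implicits.

Fact mV_submod_closed s : submod_closed (mV_pred s).
Proof.
split=> [|a _ _ /asboolP[l ->] /asboolP[l' ->]]; apply/asboolP.
  by exists [::]; rewrite big_nil.
exists ([seq Tagged (fun r => (hom C r s * V r)%type)
          ((tagged t).1, a *: (tagged t).2) | t <- l] ++ l').
rewrite big_cat big_map scaler_sumr /=; congr (_ + _).
by apply: eq_bigr => t _; rewrite linearZ.
Qed.
Fact mV_submod_act r s (f : hom C r s) (v : V r) :
  v \in mV_pred r -> act f v \in mV_pred s.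
Proof.
move=> /asboolP[l ->]; case: (leqP r s) => [rs|sr]; last first.
  rewrite (hom_directed sr f); apply/asboolP; exists [::].
  by rewrite big_nil act0l.
rewrite linear_sum; elim/big_ind: _ => [||t tr].
- exact: (mV_submod_closed s).1.
- move=> x y hx hy; rewrite -[x]scale1r; exact: (mV_submod_closed s).2.
apply/asboolP; exists [:: Tagged (fun r => (hom C r s * V r)%type)
  (mcomp f (tagged t).1, (tagged t).2)].
by rewrite big_cons big_nil /= (leq_trans tr rs) addr0 act_comp.
Qed.
Definition mV_submod : submod V := SubMod mV_submod_closed mV_submod_act.

Definition H0 : cmod := quot_cmod mV_submod.

End H0.

Section H0Map.
Variables (V W : cmod) (f : chom V W).

Fact chom_mV s (v : V s) : v \in mV_submod V s -> f s v \in mV_submod W s.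
Proof.
move=> /asboolP[l ->]; apply/asboolP.
exists [seq Tagged (fun r => (hom C r s * W r)%type)
          ((tagged t).1, f _ (tagged t).2) | t <- l].
by rewrite linear_sum big_map; apply: eq_bigr => t _; rewrite /= chom_act.
Qed.

Definition H0_val s : H0 V s -> H0 W s := quot_map _ (f s).

Lemma H0_valE s (v : V s) :
  H0_val (quot_pi _ v) = quot_pi (submodP (mV_submod W) s) (f s v).
Proof. by apply: quot_mapE => {}v; exact: chom_mV. Qed.
Fact H0_linear s : linear (@H0_val s).
Proof. by apply: quot_map_linear => v; exact: chom_mV. Qed.
Fact H0_act r s (g : hom C r s) (x : H0 V r) :
  H0_val (act g x) = act g (H0_val x).
Proof.
rewrite -[x]quot_reprK -(quot_proj_act (mV_submod V)) !H0_valE chom_act.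
exact: quot_proj_act.
Qed.
Definition H0_map : chom (H0 V) (H0 W) := CHom H0_linear H0_act.

End H0Map.

(** ** The standard free resolution *)

(* The direct sum of copies of [representable r] indexed by all [r] and all
   elements of [V r]. *)
Section FreeModule.
Variable V : cmod.

Definition free_index : choiceType := {r : nat & V r}.
Definition free_val (s : nat) : lmodType k :=
  dsum (fun i : free_index => representable (tag i) s).

Fact free_supp r s (f : hom C r s) (x : free_val r) :
  finite_set [set i | act f (x i) != 0].
Proof.
apply: sub_finite_set (dsum_supp x) => i /=.
apply: contraNN => /eqP ->; apply/eqP.
exact: (linear0 (@act (representable (tag i)) r s f)).
Qed.
Definition free_act r s (f : hom C r s) (x : free_val r) : free_val s :=
  Dsum (free_supp f x).

Fact free_linearl r s (x : free_val r) :
  linear (fun f : hom C r s => free_act f x).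
Proof. by move=> a f g; apply: dsumP => i; rewrite dsumE; exact: act_linearl. Qed.
Fact free_linearr r s (f : hom C r s) : linear (free_act f).
Proof.
move=> a x y; apply: dsumP => i; rewrite [RHS]dsumE.
rewrite -(@act_linearr (representable (tag i))).
refine (congr1 (@act (representable (tag i)) r s f) (dsumE a x y i)).
Qed.
Fact free_id s (x : free_val s) : free_act (idm C s) x = x.
Proof. by apply: dsumP => i; exact: act_id. Qed.
Fact free_comp r s t (g : hom C s t) (f : hom C r s) (x : free_val r) :
  free_act (mcomp g f) x = free_act g (free_act f x).
Proof. by apply: dsumP => i; exact: act_comp. Qed.

Definition free_cmod : cmod :=
  CMod free_linearl free_linearr free_id free_comp.

Definition aug_val s (x : free_cmod s) : V s :=
  \sum_(i \in [set: free_index]) act (x i) (tagged i).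

Lemma aug_valE s (x : free_cmod s) (A : {fset free_index}) :
  (forall i, i \notin A -> x i = 0) ->
  aug_val x = \sum_(i <- A) act (x i) (tagged i).
Proof.
by move=> xA; apply: fsbigTE => i /xA ->; exact: act0l.
Qed.

Fact aug_linear s : linear (@aug_val s).
Proof.
move=> a x y.
have fin : finite_set ([set i | x i != 0] `|` [set i | y i != 0]).
  by rewrite finite_setU; split; exact: dsum_supp.
have [A hA] := finite_fsetP.1 fin.
have xA i : i \notin A -> x i = 0.
  by apply: contraNeq => xi; have : [set` A] i by rewrite -hA; left.
have yA i : i \notin A -> y i = 0.
  by apply: contraNeq => yi; have : [set` A] i by rewrite -hA; right.
rewrite (aug_valE xA) (aug_valE yA) (@aug_valE _ _ A); last first.
  by move=> i iA; rewrite dsumE xA // yA // scaler0 addr0.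
rewrite scaler_sumr -big_split; apply: eq_bigr => i _.
by rewrite dsumE act_linearl.
Qed.

Fact aug_act r s (f : hom C r s) (x : free_cmod r) :
  aug_val (act f x) = act f (aug_val x).
Proof.
have [A hA] := finite_fsetP.1 (dsum_supp x).
have xA i : i \notin A -> x i = 0.
  by apply: contraNeq => xi; have : [set` A] i by rewrite -hA.
rewrite (aug_valE xA) (@aug_valE _ _ A); last first.
  move=> i iA; rewrite /= xA //.
  exact: (linear0 (@act (representable (tag i)) r s f)).
by rewrite linear_sum; apply: eq_bigr => i _; rewrite /= act_comp.
Qed.

Definition aug : chom free_cmod V := CHom aug_linear aug_act.

End FreeModule.

(* The resolution [... -> free_res V 1 -> free_res V 0 -> V -> 0]: [syz V i] is
   the [i]-th syzygy, and [res_diff V i : free_res V i.+1 -> free_res V i] is the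
   cover of [syz V i.+1] followed by its inclusion in [free_res V i]. *)
Fixpoint syz (V : cmod) (i : nat) : cmod :=
  if i is j.+1 then sub_cmod (ker_submod (aug (syz V j))) else V.

Definition free_res (V : cmod) (i : nat) : cmod := free_cmod (syz V i).

Definition res_diff (V : cmod) (i : nat) :
  chom (free_res V i.+1) (free_res V i) :=
  comp_chom (sub_incl (ker_submod (aug (syz V i)))) (aug (syz V i.+1)).

(** ** Homology, homological degrees and regularity *)

(* The left derived functors of [V |-> V / mV], that is, Tor_i(C/m, V); the
   zeroth one is [V / mV] itself, this functor being right exact. *)
Definition Tor (i : nat) (V : cmod) : cmod :=
  if i is j.+1 then homology (H0_map (res_diff V j.+1)) (H0_map (res_diff V j))
  else H0 V.

(* [supremum x0 A] is [x0] when [A] is empty, which gives the value [-1]. *)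
Definition hd (i : nat) (V : cmod) : \bar int :=
  supremum (-1)%:E [set s%:Z%:E | s in [set s | exists x : Tor i V s, x != 0]].

Definition reg (V : cmod) : \bar int :=
  supremum -oo%E [set (hd i V - i%:Z%:E)%E | i in [set: nat]].

End LinearCategories.

(* Main.v *)
From HB Require Import structures.
From mathcomp Require Import all_boot all_order all_algebra.
From mathcomp Require Import finmap.
From mathcomp Require Import boolp classical_sets cardinality fsbigop.
From mathcomp Require Import constructive_ereal.
Require Import Defs.

Set Implicit Arguments.
Unset Strict Implicit.
Unset Printing Implicit Defensive.

Import Order.TTheory GRing.Theory Num.Theory.
Local Open Scope ring_scope.

Arguments mV_submod {k C} V.
Arguments aug {k C} V.
Arguments chom_val {k C V W} _ s _.
Arguments submod_val {k C V} _ s _.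

(** The theorem is proved by induction on [d] for all modules [V] that are
    generated in degrees [< d] and finitely generated over [k] in each degree;
    a finitely generated module is of this kind. Let [S] be the shift,
    [mu : Id -> S] the transformation that makes it generic, and [D V] the
    cokernel of [mu V]. Regularity is handled through the vanishing of
    [Tor_i(V)] in the degrees [>= c + i] for some [c] ([finite_reg]).

    Regularity can be read off on [S V], and often on [D V]. If [S V] vanishes
    modulo [m] in degree [s], then so does [V] in degree [s + 1], because
    [S] only renumbers degrees; the same holds for [D V], because [mu] takes
    its values in [m]. Apply this to all the syzygies of [V], covered by finite
    sums of representables [M(r)] with [r] bounded by the degree of generation
    just found. The functor [S] is exact and [reg (S M(r)) <= r], so the long
    exact sequence bounds the homology of the shifted syzygies step by step
    ([Tor_zero_of_image]); hence [S V] of finite regularity gives [V] of finite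
    regularity ([finite_reg_shift]). The functor [D] is only right exact, but
    its first derived functor is [ker mu], which is zero on submodules of
    free modules; so [D V] of finite regularity gives [V] of finite regularity
    whenever [mu V] is injective ([finite_reg_coker]).

    The point of [D] is that it lowers the degree of generation by one, since
    [D M(r)] is generated in degrees [< r] ([gen_lt_coker]). If [mu V] is
    injective, the induction hypothesis for [D V] therefore concludes. In
    general let [T] be the union of the kernels of the maps [V -> S^n V]. Then
    [mu] is injective on [V' = V / T], so [V'] has finite regularity.
    The bound on [Tor_1(V')] bounds the degrees of the generators of [T], and
    as [k] is noetherian, [T] is the kernel of a single [V -> S^n V]
    ([torsion_bounded]). The cokernel of [V' -> S^n V] is filtered by quotients
    of the modules [D (S^j V)], so it is generated in degrees [< d - 1] and the
    induction hypothesis applies to it. Hence [S^n V], an extension of two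
    modules of finite regularity, has finite regularity, and so has [V]
    ([finite_reg_gen_lt]).

    Homology is defined by the standard free resolution, which is functorial
    but not exact as a functor of the module. The long exact sequence is
    obtained by rotating short exact sequences ([ses_rotate]) and by a
    comparison of projective covers in the manner of Schanuel ([schanuel]). *)

(** * Short exact sequences and direct sums *)
Section Basics.
Variables (k : comPzRingType) (C : lincat k).
Implicit Types A B V W X Y L P Q : cmod C.

Lemma chom0 V W (f : chom V W) s : f s 0 = 0.
Proof. exact: linear0. Qed.
Lemma chomD V W (f : chom V W) s : {morph f s : u v / u + v}.
Proof. exact: linearD. Qed.
Lemma chomB V W (f : chom V W) s : {morph f s : u v / u - v}.
Proof. exact: linearB. Qed.

Lemma submod0 V (N : submod V) s : (0 : V s) \in N s.
Proof. exact: (submodP N s).1. Qed.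

Lemma submodZD V (N : submod V) s a (u v : V s) :
  u \in N s -> v \in N s -> a *: u + v \in N s.
Proof. exact: (submodP N s).2. Qed.

Lemma submodD V (N : submod V) s (u v : V s) :
  u \in N s -> v \in N s -> u + v \in N s.
Proof. by move=> uN vN; rewrite -[u]scale1r; exact: submodZD. Qed.

Lemma submodN V (N : submod V) s (v : V s) : v \in N s -> - v \in N s.
Proof. by move=> vN; rewrite -[- v]addr0 -scaleN1r; exact/submodZD/submod0. Qed.

Lemma submodB V (N : submod V) s (u v : V s) :
  u \in N s -> v \in N s -> u - v \in N s.
Proof. by move=> uN vN; apply: submodD => //; exact: submodN. Qed.

Lemma act_mV V r s (f : hom C r s) (v : V r) :
  (r < s)%N -> act f v \in mV_submod V s.
Proof.
move=> rs; apply/asboolP; exists [:: Tagged (fun r => (hom C r s * V r)%type) (f, v)].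
by rewrite big_cons big_nil /= rs addr0.
Qed.

Lemma mV_ind V s (N : V s -> Prop) :
    N 0 -> (forall x y, N x -> N y -> N (x + y)) ->
    (forall r (f : hom C r s) (v : V r), (r < s)%N -> N (act f v)) ->
  forall x, x \in mV_submod V s -> N x.
Proof.
move=> N0 ND NA x /asboolP[l ->]; elim/big_ind: _ => // -[r [f v]] /= rs.
exact: NA.
Qed.

Definition surj V W (g : chom V W) : Prop := forall s w, exists v, g s v = w.

(** This is the right exactness of [V |-> V / mV], on elements. *)
Lemma lift_mV V W (g : chom V W) : surj g ->
  forall s w, w \in mV_submod W s -> exists2 v, v \in mV_submod V s & g s v = w.
Proof.
move=> gsurj s; apply: mV_ind.
- by exists 0; [exact: submod0 | rewrite linear0].
- move=> _ _ [u um <-] [v vm <-]; exists (u + v); first exact: submodD.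
  by rewrite linearD.
- move=> r f w rs; have [v <-] := gsurj r w.
  by exists (act f v); [exact: act_mV | rewrite chom_act].
Qed.

Record ses A B X (f : chom A B) (g : chom B X) : Prop := Ses {
  ses_inj : forall s, injective (f s);
  ses_surj : surj g;
  ses_comp : forall s a, g s (f s a) = 0;
  ses_exact : forall s b, g s b = 0 -> exists a, f s a = b }.

Lemma inj_of_ker A B (f : chom A B) :
  (forall s a, f s a = 0 -> a = 0) -> forall s, injective (f s).
Proof.
move=> f0 s a b e; apply/eqP; rewrite -subr_eq0; apply/eqP/f0.
by rewrite linearB /= e subrr.
Qed.

Lemma ses_ker A B (g : chom A B) : surj g -> ses (sub_incl (ker_submod g)) g.
Proof.
move=> gs; split=> // [s|s a|s b /eqP gb]; first exact: val_inj.
  by have := valP a; rewrite inE => /eqP.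
have kb : b \in ker_submod g s by rewrite inE.
by exists (exist _ b kb : sub_cmod (ker_submod g) s).
Qed.

Lemma ses_quot V (N : submod V) : ses (sub_incl N) (quot_proj N).
Proof.
split=> // [s|s w|s a|s b /quot_pi_eq0 bN]; first exact: val_inj.
- by exists (quot_repr w); exact: quot_reprK.
- by apply/quot_pi_eq0; exact: valP.
- by exists (exist _ b bN : sub_cmod N s).
Qed.

Lemma ses_coker A B (f : chom A B) : (forall s, injective (f s)) ->
  ses f (quot_proj (im_submod f)).
Proof.
move=> fi; split=> // [s w|s a|s b /quot_pi_eq0 /asboolP //].
- by exists (quot_repr w); exact: quot_reprK.
- by apply/quot_pi_eq0/asboolP; exists a.
Qed.

Lemma factor_inj A B X (f : chom A B) (g : chom X B) :
    (forall s, injective (f s)) -> (forall s x, exists a, f s a = g s x) ->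
  exists h : chom X A, forall s x, f s (h s x) = g s x.
Proof.
move=> fi gf; pose h s x := projT1 (cid (gf s x)).
have hE s x : f s (h s x) = g s x by rewrite /h; case: cid.
have hl s : linear (h s).
  by move=> a x y; apply: fi; rewrite linearP /= !hE linearP.
have ha r s (c : hom C r s) x : h s (act c x) = act c (h r x).
  by apply: fi; rewrite chom_act !hE chom_act.
by exists (CHom hl ha).
Qed.

Lemma factor_surj A B X (q : chom A B) (g : chom A X) :
    surj q -> (forall s a, q s a = 0 -> g s a = 0) ->
  exists h : chom B X, forall s a, h s (q s a) = g s a.
Proof.
move=> qs qg; pose r s b := projT1 (cid (qs s b)).
have rE s b : q s (r s b) = b by rewrite /r; case: cid.
have gE s a b : q s a = q s b -> g s a = g s b.
  move=> e; apply/eqP; rewrite -subr_eq0 -linearB; apply/eqP/qg.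
  by rewrite linearB /= e subrr.
pose h s b := g s (r s b).
have hl s : linear (h s).
  by move=> a x y; rewrite /h -linearP; apply: gE; rewrite linearP /= !rE.
have ha i s (c : hom C i s) x : h s (act c x) = act c (h i x).
  by rewrite /h -chom_act; apply: gE; rewrite chom_act !rE.
by exists (CHom hl ha) => s a; apply: gE; rewrite rE.
Qed.

Fact id_chom_linear V s : linear (fun v : V s => v). Proof. by []. Qed.
Definition id_chom V : chom V V :=
  @CHom k C V V (fun s v => v) (@id_chom_linear V) (fun r s f v => erefl).

Section DirectSum2.
Variables V W : cmod C.
Definition dsum2_val s : lmodType k := (V s * W s)%type.
Definition dsum2_act r s (f : hom C r s) (x : dsum2_val r) : dsum2_val s :=
  (act f x.1, act f x.2).
Fact dsum2_linearl r s (x : dsum2_val r) :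
  linear (fun f : hom C r s => dsum2_act f x).
Proof. by move=> a f g; congr (_, _); exact: act_linearl. Qed.
Fact dsum2_linearr r s (f : hom C r s) : linear (dsum2_act f).
Proof. by move=> a x y; congr (_, _); exact: linearP. Qed.
Fact dsum2_id s (x : dsum2_val s) : dsum2_act (idm C s) x = x.
Proof. by case: x => x y; congr (_, _); exact: act_id. Qed.
Fact dsum2_comp r s t (g : hom C s t) (f : hom C r s) (x : dsum2_val r) :
  dsum2_act (mcomp g f) x = dsum2_act g (dsum2_act f x).
Proof. by congr (_, _); exact: act_comp. Qed.
Definition dsum2 : cmod C :=
  CMod dsum2_linearl dsum2_linearr dsum2_id dsum2_comp.

Fact inl_linear s : linear (fun v : V s => (v, 0) : dsum2 s).
Proof. by move=> a x y; congr (_, _); rewrite /= scaler0 addr0. Qed.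
Fact inl_act r s (f : hom C r s) (v : V r) :
  (act f v, 0) = act f ((v, 0) : dsum2 r) :> dsum2 s.
Proof. by rewrite /= /dsum2_act /= linear0. Qed.
Definition inl_chom : chom V dsum2 := CHom inl_linear inl_act.

Fact inr_linear s : linear (fun w : W s => (0, w) : dsum2 s).
Proof. by move=> a x y; congr (_, _); rewrite /= scaler0 addr0. Qed.
Fact inr_act r s (f : hom C r s) (w : W r) :
  (0, act f w) = act f ((0, w) : dsum2 r) :> dsum2 s.
Proof. by rewrite /= /dsum2_act /= linear0. Qed.
Definition inr_chom : chom W dsum2 := CHom inr_linear inr_act.

Fact snd_linear s : linear (fun x : dsum2 s => x.2). Proof. by []. Qed.
Fact snd_act r s (f : hom C r s) (x : dsum2 r) : (act f x).2 = act f x.2.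
Proof. by []. Qed.
Definition snd_chom : chom dsum2 W := CHom snd_linear snd_act.

Lemma ses_dsum2 : ses inl_chom snd_chom.
Proof.
split=> [s u v [] //|s w|//|s [v w] /= ->]; first by exists (0, w).
by exists v.
Qed.

Lemma dsum2E s (x : dsum2 s) : x = inl_chom s x.1 + inr_chom s x.2.
Proof. by case: x => u v /=; congr (_, _); rewrite (addr0, add0r). Qed.

Section Copair.
Variables (X : cmod C) (f : chom V X) (g : chom W X).
Fact copair_linear s : linear (fun x : dsum2 s => f s x.1 + g s x.2).
Proof. by move=> a x y /=; rewrite !linearP /= scalerDr addrACA. Qed.
Fact copair_act r s (h : hom C r s) (x : dsum2 r) :
  f s (act h x).1 + g s (act h x).2 = act h (f r x.1 + g r x.2).
Proof. by rewrite linearD /= !chom_act. Qed.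
Definition copair : chom dsum2 X := CHom copair_linear copair_act.
End Copair.

Section Pair.
Variables (X : cmod C) (f : chom X V) (g : chom X W).
Fact pair_linear s : linear (fun x : X s => (f s x, g s x) : dsum2 s).
Proof. by move=> a x y /=; congr (_, _); exact: linearP. Qed.
Fact pair_act r s (h : hom C r s) (x : X r) :
  (f s (act h x), g s (act h x)) = act h ((f r x, g r x) : dsum2 r) :> dsum2 s.
Proof. by congr (_, _); exact: chom_act. Qed.
Definition pair_chom : chom X dsum2 := CHom pair_linear pair_act.
End Pair.
End DirectSum2.

Definition sub_chom_val V W (f g : chom V W) s (v : V s) := f s v - g s v.
Fact sub_chom_linear V W (f g : chom V W) s : linear (@sub_chom_val V W f g s).
Proof.
move=> a x y; rewrite /sub_chom_val (chom_linear f) (chom_linear g).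
by rewrite scalerBr opprD addrACA.
Qed.
Fact sub_chom_act V W (f g : chom V W) r s (h : hom C r s) (v : V r) :
  sub_chom_val f g (act h v) = act h (sub_chom_val f g v).
Proof. by rewrite /sub_chom_val linearB /= !chom_act. Qed.
Definition sub_chom V W (f g : chom V W) : chom V W :=
  CHom (sub_chom_linear f g) (sub_chom_act f g).

End Basics.
Arguments id_chom {k C} V.

(** * Projective modules and covers *)
Section Projectives.
Variables (k : comPzRingType) (C : lincat k).
Implicit Types A B V W X Y L P Q : cmod C.

Definition projective P : Prop :=
  forall X Y (q : chom X Y) (f : chom P Y), surj q ->
    exists h : chom P X, forall s x, q s (h s x) = f s x.

Section FreeEval.
Variables (V X : cmod C) (phi : forall i : free_index V, X (tag i)).

Definition free_eval_val s (x : free_cmod V s) : X s :=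
  \sum_(i \in [set: free_index V]) act (x i) (phi i).

Lemma free_eval_valE s (x : free_cmod V s) (A : {fset free_index V}) :
  (forall i, i \notin A -> x i = 0) ->
  free_eval_val x = \sum_(i <- A) act (x i) (phi i).
Proof. by move=> xA; apply: fsbigTE => i /xA ->; exact: act0l. Qed.

Lemma free_suppP s (x : free_cmod V s) :
  exists A : {fset free_index V}, forall i, i \notin A -> x i = 0.
Proof.
have [A hA] := finite_fsetP.1 (dsum_supp x); exists A => i.
by apply: contraNeq => xi; have : [set` A]%classic i by rewrite -hA.
Qed.

Fact free_eval_linear s : linear (@free_eval_val s).
Proof.
move=> a x y.
have [A xA] := free_suppP x; have [B yB] := free_suppP y.
have xAB i : i \notin (A `|` B)%fset -> x i = 0.
  by rewrite in_fsetU negb_or => /andP[/xA].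
have yAB i : i \notin (A `|` B)%fset -> y i = 0.
  by rewrite in_fsetU negb_or => /andP[_ /yB].
rewrite (free_eval_valE xAB) (free_eval_valE yAB).
rewrite (@free_eval_valE _ _ (A `|` B)%fset); last first.
  by move=> i iAB; rewrite dsumE xAB // yAB // scaler0 addr0.
rewrite scaler_sumr -big_split; apply: eq_bigr => i _.
by rewrite dsumE act_linearl.
Qed.

Fact free_eval_act r s (f : hom C r s) (x : free_cmod V r) :
  free_eval_val (act f x) = act f (free_eval_val x).
Proof.
have [A xA] := free_suppP x.
rewrite (free_eval_valE xA) (@free_eval_valE _ _ A); last first.
  move=> i iA; rewrite /= xA //.
  exact: (linear0 (@act _ _ (representable C (tag i)) r s f)).
by rewrite linear_sum; apply: eq_bigr => i _; rewrite /= act_comp.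
Qed.

Definition free_eval : chom (free_cmod V) X :=
  CHom free_eval_linear free_eval_act.

End FreeEval.

Section FreeDelta.
Variable V : cmod C.

Definition free_delta_val (i : free_index V) (j : free_index V) :
    representable C (tag j) (tag i) :=
  dfwith (fun j : free_index V => 0 : representable C (tag j) (tag i))
    (idm C (tag i)) j.

Fact free_delta_supp (i : free_index V) :
  finite_set [set j | free_delta_val i j != 0]%classic.
Proof.
apply: sub_finite_set (finite_set1 i) => j /=.
move=> dij; apply/eqP; apply: contraNT dij => ij.
by rewrite /free_delta_val dfwith_out // eq_sym.
Qed.

Definition free_delta i : free_cmod V (tag i) := Dsum (free_delta_supp i).

Lemma free_expand s (x : free_cmod V s) (A : {fset free_index V}) :
  (forall i, i \notin A -> x i = 0) ->
  x = \sum_(i <- A) act (x i) (free_delta i).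
Proof.
move=> xA; apply: dsumP => j.
have -> : (\sum_(i <- A) act (x i) (free_delta i)) j =
    \sum_(i <- A) (act (x i) (free_delta i) : free_cmod V s) j.
  apply: (big_morph (fun y : free_cmod V s => y j)) => // y z.
  by have := dsumE 1 y z j; rewrite !scale1r.
have F i : i != j -> (act (x i) (free_delta i) : free_cmod V s) j = 0.
  move=> ij; rewrite /= /free_delta_val dfwith_out //.
  exact: (linear0 (@act _ _ (representable C (tag j)) _ _ (x i))).
have Fj : (act (x j) (free_delta j) : free_cmod V s) j = x j.
  by rewrite /= /free_delta_val dfwith_in comp_idr.
have [jA|jA] := boolP (j \in A).
  rewrite (big_fsetD1 j jA) Fj big_seq big1; first exact: esym (addr0 _).
  by move=> i; rewrite in_fsetD1 => /andP[ij _]; exact: F.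
rewrite xA // big_seq big1 // => i iA; apply: F.
by apply: contraNneq jA => <-.
Qed.

Lemma free_ext X (f g : chom (free_cmod V) X) :
  (forall i, f (tag i) (free_delta i) = g (tag i) (free_delta i)) ->
  forall s x, f s x = g s x.
Proof.
move=> fg s x; have [A xA] := free_suppP x.
rewrite [x](free_expand xA) !linear_sum; apply: eq_bigr => i _.
by rewrite /= !chom_act fg.
Qed.

Lemma free_eval_delta X (phi : forall i : free_index V, X (tag i)) i :
  free_eval phi (tag i) (free_delta i) = phi i.
Proof.
rewrite /= (@free_eval_valE _ _ _ _ _ [fset i]%fset); last first.
  by move=> j; rewrite in_fset1 eq_sym => ij; rewrite /= /free_delta_val dfwith_out.
by rewrite big_seq_fset1 /= /free_delta_val dfwith_in act_id.
Qed.

Lemma free_projective : projective (free_cmod V).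
Proof.
move=> X Y q f qs.
pose phi (i : free_index V) := projT1 (cid (qs (tag i) (f (tag i) (free_delta i)))).
have phiE i : q (tag i) (phi i) = f (tag i) (free_delta i) by rewrite /phi; case: cid.
exists (free_eval phi) => s x.
apply: (@free_ext _ (comp_chom q (free_eval phi)) f) => i.
by rewrite -phiE -[in RHS](free_eval_delta phi).
Qed.

Lemma aug_surj : surj (aug V).
Proof.
move=> s v; exists (free_delta (Tagged (fun r => V r) v)).
exact: (free_eval_delta (fun i => tagged i) (Tagged (fun r => V r) v)).
Qed.

End FreeDelta.

Section Yoneda.
Variables (V : cmod C) (r : nat) (v : V r).

Fact yoneda_linear s : linear (fun g : representable C r s => act g v).
Proof. exact: act_linearl. Qed.
Fact yoneda_act s t (g : hom C s t) (u : representable C r s) :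
  act (act g u) v = act g (act u v).
Proof. exact: act_comp. Qed.
Definition yoneda : chom (representable C r) V := CHom yoneda_linear yoneda_act.

Lemma yoneda_id : yoneda r (idm C r) = v.
Proof. exact: act_id. Qed.

End Yoneda.

Lemma representable_projective r : projective (representable C r).
Proof.
move=> X Y q f qs; have [x qx] := qs r (f r (idm C r)).
exists (yoneda x) => s g /=; rewrite chom_act qx -chom_act.
by congr (f s _); exact: comp_idr.
Qed.

Definition retract X Y : Prop :=
  exists i : chom X Y, exists r : chom Y X, forall s x, r s (i s x) = x.

Lemma retract_refl X : retract X X.
Proof. by exists (id_chom X), (id_chom X). Qed.

Lemma projective_retract P Q : retract P Q -> projective Q -> projective P.
Proof.
move=> [i [r ri]] Qp X Y q f qs; have [h hE] := Qp X Y q (comp_chom f r) qs.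
by exists (comp_chom h i) => s x; rewrite /= hE /= ri.
Qed.

Lemma ses_split A B P (f : chom A B) (g : chom B P) : ses f g -> projective P ->
  exists r : chom B A, forall s a, r s (f s a) = a.
Proof.
move=> S Pp; have [h hE] := Pp _ _ g (id_chom P) (ses_surj S).
have [||r rE] := @factor_inj _ _ _ _ _ f (sub_chom (id_chom B) (comp_chom h g)).
- exact: ses_inj S.
- move=> s x; apply: (ses_exact S).
  by rewrite /= /sub_chom_val linearB /= hE subrr.
exists r => s a; apply: (ses_inj S); rewrite rE /= /sub_chom_val /=.
by rewrite (ses_comp S) linear0 subr0.
Qed.

(** Lift the maps [X -> Y -> X] to maps [u : P -> P'] and [v : P' -> P]. They
    restrict to the kernels, and [1 - v u] lifts zero, hence factors through
    [L]. So the identity of [L] is the sum of a map that factors through [L']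
    and of one that factors through [P]. The embedding of [L] is given
    explicitly because its effect on [L / mL] matters in degree one. *)
Lemma schanuel L P X L' P' Y (f : chom L P) (g : chom P X)
    (f' : chom L' P') (g' : chom P' Y) :
    ses f g -> ses f' g' -> projective P -> projective P' -> retract X Y ->
  exists (u : chom P P') (a : chom L L') (b : chom (dsum2 L' P) L),
    (forall s x, f' s (a s x) = u s (f s x)) /\
    (forall s x, b s (pair_chom a f s x) = x).
Proof.
move=> S S' Pp Pp' [i [r ri]].
have [u uE] := Pp _ _ g' (comp_chom i g) (ses_surj S').
have [v vE] := Pp' _ _ g (comp_chom r g') (ses_surj S).
have [|a aE] := @factor_inj _ _ _ _ _ f' (comp_chom u f) (ses_inj S').
  by move=> s x; apply: (ses_exact S'); rewrite /= uE /= (ses_comp S) linear0.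
have [|b bE] := @factor_inj _ _ _ _ _ f (comp_chom v f') (ses_inj S).
  by move=> s x; apply: (ses_exact S); rewrite /= vE /= (ses_comp S') linear0.
have [|c cE] := @factor_inj _ _ _ _ _ f (sub_chom (id_chom P) (comp_chom v u))
    (ses_inj S).
  move=> s x; apply: (ses_exact S).
  by rewrite /= /sub_chom_val linearB /= vE /= uE /= ri subrr.
exists u, a, (copair b c); split=> [s x|s x]; first exact: aE.
apply: (ses_inj S).
by rewrite /= linearD /= bE cE /= /sub_chom_val /= aE /= addrC subrK.
Qed.

End Projectives.

(** * Vanishing of homology and long exact sequences *)
Section TorVanishing.
Variables (k : comPzRingType) (C : lincat k).
Implicit Types A B V W X Y L P Q : cmod C.

(** An inductive wrapper: comparing two such statements compares the modules,
    without unfolding their resolutions. *)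
Variant Tor_zero i V s : Prop := TorZero of forall x : Tor i V s, x = 0.

Lemma Tor_zero0 V s : Tor_zero 0 V s <-> forall v : V s, v \in mV_submod V s.
Proof.
split=> [[h] v|h]; first by apply/(quot_pi_eq0 (submodP (mV_submod V) s))/h.
constructor=> x; rewrite -[x]quot_reprK.
exact/(quot_pi_eq0 (submodP (mV_submod V) s))/h.
Qed.

Lemma homology_zero (U V W : cmod C) (f : chom U V) (g : chom V W) s :
  (forall x : homology f g s, x = 0) <->
  (forall v, g s v = 0 -> exists u, f s u = v).
Proof.
split=> [h v gv|h x].
  have kv : v \in ker_submod g s by rewrite inE gv.
  have := h (quot_proj _ s (exist _ v kv : sub_cmod (ker_submod g) s)).
  by move=> /quot_pi_eq0 /asboolP.
rewrite -[x]quot_reprK; apply/quot_pi_eq0; apply/asboolP; apply: h.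
by have /eqP := valP (quot_repr x).
Qed.

Lemma H0_mapE V W (f : chom V W) s (v : V s) :
  H0_map f s (quot_proj (mV_submod V) s v) = quot_proj (mV_submod W) s (f s v).
Proof. exact: H0_valE. Qed.

Lemma H0_eq0 V s (v : V s) :
  quot_proj (mV_submod V) s v = 0 <-> v \in mV_submod V s.
Proof. exact: quot_pi_eq0. Qed.

Lemma H0_surj V s (x : H0 V s) : exists v, quot_proj (mV_submod V) s v = x.
Proof. by exists (quot_repr x); exact: quot_reprK. Qed.

(** [Tor_1(X)] is the kernel of [H0 (syz X 1) -> H0 (free_cmod X)]: the second
    syzygy covers the kernel of the map onto the first one, and [H0] is right
    exact. *)
Lemma Tor_zero1_std X s : Tor_zero 1 X s <->
  forall a : syz X 1 s, val a \in mV_submod (free_cmod X) s ->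
    a \in mV_submod (syz X 1) s.
Proof.
split=> [[/homology_zero h] a am|h]; last first.
  constructor; apply/homology_zero => x; have [v <-] := H0_surj x.
  rewrite H0_mapE => /H0_eq0 vm.
  have /(lift_mV (@aug_surj _ _ _)) [w wm wE] := h (aug (syz X 1) s v) vm.
  have : aug (syz X 1) s (v - w) = 0 by rewrite chomB wE subrr.
  move=> /(ses_exact (ses_ker (@aug_surj _ _ (syz X 1)))) [b bE].
  have [c cE] := aug_surj b.
  exists (quot_proj (mV_submod _) s c); rewrite H0_mapE.
  apply/eqP; rewrite -subr_eq0 -chomB; apply/eqP/H0_eq0.
  have -> : res_diff X 1 s c = v - w by rewrite -bE -cE.
  by rewrite addrAC subrr add0r; exact: submodN.
have [v va] := aug_surj a.
have [|y] := h (quot_proj (mV_submod _) s v).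
  by rewrite H0_mapE; apply/H0_eq0; rewrite -va in am.
have [w <-] := H0_surj y.
rewrite H0_mapE => e.
have : v - (res_diff X 1) s w \in mV_submod (free_res X 1) s.
  by apply/H0_eq0; rewrite chomB; apply/eqP; rewrite subr_eq0; apply/eqP/esym/e.
move=> /(chom_mV (aug (syz X 1))).
rewrite chomB va.
by rewrite (ses_comp (ses_ker (@aug_surj _ _ (syz X 1)))) subr0.
Qed.

(** A lift of [p] along [q] maps [E] to [A]. An element of [mL] is the image of
    one of [mP] up to an element of [mA]; this transports the injectivity of
    [E / mE -> P / mP] to [A / mA -> L / mL]. *)
Lemma Tor_zero1_cover E P X (e : chom E P) (p : chom P X) s :
    ses e p -> projective P ->
    (forall a, e s a \in mV_submod P s -> a \in mV_submod E s) ->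
  forall A L (f : chom A L) (q : chom L X), ses f q ->
    forall a, f s a \in mV_submod L s -> a \in mV_submod A s.
Proof.
move=> Sp Pp h A L f q S a fam.
have [u uE] := Pp _ _ q p (ses_surj S).
suff D l : l \in mV_submod L s -> exists2 y, y \in mV_submod P s &
    exists2 a, a \in mV_submod A s & l = u s y + f s a.
  have [y ym [b bm fE]] := D _ fam.
  have : p s y = 0.
    by rewrite -uE -[u s y](addrK (f s b)) -fE chomB !(ses_comp S) subrr.
  move=> /(ses_exact Sp) [c cE].
  have cm : c \in mV_submod E s by apply: h; rewrite cE.
  have [|v vE] := @factor_inj _ _ _ _ _ f (comp_chom u e) (ses_inj S).
    by move=> t x; apply: (ses_exact S); rewrite /= uE (ses_comp Sp).
  have -> : a = v s c + b.
    by apply: (ses_inj S); rewrite fE -cE chomD vE.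
  by apply: submodD => //; exact: chom_mV.
move: l; apply: mV_ind.
- exists 0; first exact: submod0.
  by exists 0; [exact: submod0 | rewrite !chom0 addr0].
- move=> _ _ [x xm [b bm ->]] [y ym [c cm ->]].
  exists (x + y); first exact: submodD.
  by exists (b + c); [exact: submodD | rewrite !chomD addrACA].
- move=> r c l rs; have [y yE] := ses_surj Sp (q r l).
  have [|b bE] := @ses_exact _ _ _ _ _ _ _ S r (l - u r y).
    by rewrite chomB uE yE subrr.
  exists (act c y); first exact: act_mV.
  exists (act c b); first exact: act_mV.
  by rewrite !chom_act -linearD bE addrC subrK.
Qed.

(** The kernel of [A / mA -> L / mL] is the image of [Tor_1(X)], which is itself
    this kernel when [L] is a free cover of [X]. *)
Lemma Tor_zero1 X s : Tor_zero 1 X s <->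
  forall A L (f : chom A L) (q : chom L X), ses f q ->
    forall a, f s a \in mV_submod L s -> a \in mV_submod A s.
Proof.
have S := ses_ker (@aug_surj _ _ X).
split=> [/Tor_zero1_std|h]; first exact: (Tor_zero1_cover S (@free_projective _ _ X)).
apply/Tor_zero1_std => a; exact: (h _ _ _ _ S).
Qed.

Lemma syzS V i : syz V i.+1 = syz (syz V 1) i.
Proof. by elim: i => //= i <-. Qed.

(** The same map as [res_diff X 0], with the syzygies of [X] written out, so
    that it may be taken at [syz V i] for a variable [i]. *)
Definition syz_diff X :
    chom (free_cmod (sub_cmod (ker_submod (aug X)))) (free_cmod X) :=
  comp_chom (sub_incl (ker_submod (aug X))) (aug (sub_cmod (ker_submod (aug X)))).

Definition Tor1 X : cmod C :=
  homology (H0_map (syz_diff (sub_cmod (ker_submod (aug X))))) (H0_map (syz_diff X)).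

Lemma Tor_zero_succ i V s :
  Tor_zero i.+1 V s <-> forall x : Tor1 (syz V i) s, x = 0.
Proof. by split=> [[h]|h]; [exact: h | constructor; exact: h]. Qed.

Lemma Tor_zeroSS i V s : Tor_zero i.+2 V s <-> Tor_zero i.+1 (syz V 1) s.
Proof.
apply: (iff_trans (Tor_zero_succ _ _ _)); rewrite syzS.
exact: (iff_sym (Tor_zero_succ _ _ _)).
Qed.

Lemma projective_syz P : projective P -> projective (syz P 1).
Proof.
move=> Pp; apply: projective_retract (@free_projective _ _ P).
have [r rE] := ses_split (ses_ker (@aug_surj _ _ P)) Pp.
by exists (sub_incl (ker_submod (aug P))), r.
Qed.

Lemma projective_Tor_zero i P s : projective P -> Tor_zero i.+1 P s.
Proof.
elim: i P => [|i IH] P Pp; last by apply/Tor_zeroSS/IH/projective_syz.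
apply/Tor_zero1 => A L f q S a fam; have [r rE] := ses_split S Pp.
by rewrite -(rE _ a); exact: chom_mV.
Qed.

(** The kernel [L] of [P -> B -> X] maps onto [A] with the same kernel as
    [P -> B]. When [P] is projective, [L] is a syzygy of [X] and [E] one of [B],
    so that the sequence [A, B, X] in homological degree [i + 1] becomes the
    sequence [E, L, A] in degree [i], moved by one place. *)
Lemma ses_rotate E P A B X (e : chom E P) (p : chom P B) (f : chom A B)
    (g : chom B X) : ses e p -> ses f g ->
  exists L (i : chom L P) (j : chom E L) (h : chom L A),
    [/\ ses i (comp_chom g p), ses j h, forall s x, i s (j s x) = e s x &
        forall s x, f s (h s x) = p s (i s x)].
Proof.
move=> Sp Sf; pose gp := comp_chom g p.
have gps : surj gp.
  move=> s x; have [b <-] := ses_surj Sf x; have [y <-] := ses_surj Sp b.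
  by exists y.
have SL := ses_ker gps; set i := sub_incl _ in SL.
have [|j jE] := @factor_inj _ _ _ _ _ i e (ses_inj SL).
  by move=> s x; apply: (ses_exact SL); rewrite /= (ses_comp Sp) chom0.
have [|h hE] := @factor_inj _ _ _ _ _ f (comp_chom p i) (ses_inj Sf).
  move=> s x; apply: (ses_exact Sf); exact: (ses_comp SL).
exists _, i, j, h; split=> //; split=> [|s a|s x|s x hx].
- apply: inj_of_ker => s x jx; apply: (ses_inj Sp).
  by rewrite -jE jx !chom0.
- have [y yE] := ses_surj Sp (f s a).
  have [|x xE] := @ses_exact _ _ _ _ _ _ _ SL s y.
    by rewrite /= yE (ses_comp Sf).
  by exists x; apply: (ses_inj Sf); rewrite hE -yE -xE.
- have pij : p s (i s (j s x)) = 0 by rewrite jE (ses_comp Sp).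
  by apply: (ses_inj Sf); rewrite hE chom0; exact: pij.
- have [|y yE] := @ses_exact _ _ _ _ _ _ _ Sp s (i s x).
    by have := hE s x; rewrite hx chom0 => /esym.
  by exists y; apply: (ses_inj SL); rewrite jE.
Qed.

Lemma ses_Tor0_mid A B X (f : chom A B) (g : chom B X) s : ses f g ->
  Tor_zero 0 A s -> Tor_zero 0 X s -> Tor_zero 0 B s.
Proof.
move=> S /Tor_zero0 Am /Tor_zero0 Xm; apply/Tor_zero0 => b.
have [c cm cE] := lift_mV (ses_surj S) (Xm (g s b)).
have [|a aE] := @ses_exact _ _ _ _ _ _ _ S s (b - c).
  by rewrite chomB cE subrr.
by rewrite -[b](subrK c) -aE; apply: submodD => //; apply: chom_mV.
Qed.

Lemma surj_Tor0 B X (g : chom B X) s : surj g ->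
  Tor_zero 0 B s -> Tor_zero 0 X s.
Proof.
move=> gs /Tor_zero0 Bm; apply/Tor_zero0 => x.
by have [b <-] := gs s x; exact: chom_mV.
Qed.

Lemma ses_Tor0_left A B X (f : chom A B) (g : chom B X) s : ses f g ->
  Tor_zero 1 X s -> Tor_zero 0 B s -> Tor_zero 0 A s.
Proof.
move=> S /Tor_zero1 X1 /Tor_zero0 Bm; apply/Tor_zero0 => a.
exact: (X1 _ _ _ _ S).
Qed.

Lemma ses_Tor1_mid A B X (f : chom A B) (g : chom B X) s : ses f g ->
  Tor_zero 1 A s -> Tor_zero 1 X s -> Tor_zero 1 B s.
Proof.
move=> S /Tor_zero1 A1 /Tor_zero1 X1; apply/Tor_zero1 => E P e p Sp a eam.
have [L [i [j [h [Si Sj ije _]]]]] := ses_rotate Sp S.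
by apply: (A1 _ _ _ _ Sj); apply: (X1 _ _ _ _ Si); rewrite ije.
Qed.

Lemma ses_Tor1_right A B X (f : chom A B) (g : chom B X) s : ses f g ->
  Tor_zero 1 B s -> Tor_zero 0 A s -> Tor_zero 1 X s.
Proof.
move=> S /Tor_zero1 B1 /Tor_zero0 A0; have Sp := ses_ker (@aug_surj _ _ B).
have [L [i [j [h [Si Sj ije _]]]]] := ses_rotate Sp S.
apply/Tor_zero1; apply: (Tor_zero1_cover Si (@free_projective _ _ B)) => x xm.
have [y ym yE] := lift_mV (ses_surj Sj) (A0 (h s x)).
have [|z zE] := @ses_exact _ _ _ _ _ _ _ Sj s (x - y).
  by rewrite chomB yE subrr.
rewrite -[x](subrK y) -zE; apply: submodD => //; apply: chom_mV.
apply: (B1 _ _ _ _ Sp); rewrite -ije zE chomB; apply: submodB => //.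
exact: chom_mV.
Qed.

(** Were [E / mE] zero in degree [s], this would be [ses_Tor1_right] for [j] and
    [h]. It is enough that [E / mE] embeds in [P / mP], which is what the
    vanishing of [Tor_1(B)] provides. *)
Lemma ses_Tor1_rotate E P A B L (e : chom E P) (p : chom P B) (i : chom L P)
    (j : chom E L) (h : chom L A) s :
    ses e p -> ses j h -> (forall s x, i s (j s x) = e s x) ->
  Tor_zero 1 B s -> Tor_zero 1 L s -> Tor_zero 1 A s.
Proof.
move=> Sp Sj ije /Tor_zero1 B1 /Tor_zero1 L1.
have Sr := ses_ker (@aug_surj _ _ L).
have [N [i' [j' [h' [Si' Sj' ije' jhp]]]]] := ses_rotate Sr Sj.
apply/Tor_zero1; apply: (Tor_zero1_cover Si' (@free_projective _ _ L)) => x xm.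
have hm : h' s x \in mV_submod E s.
  by apply: (B1 _ _ _ _ Sp); rewrite -ije jhp; do 2 apply: chom_mV.
have [y ym yE] := lift_mV (ses_surj Sj') hm.
have [|z zE] := @ses_exact _ _ _ _ _ _ _ Sj' s (x - y).
  by rewrite chomB yE subrr.
rewrite -[x](subrK y) -zE; apply: submodD => //; apply: chom_mV.
apply: (L1 _ _ _ _ Sr); rewrite -ije' zE chomB; apply: submodB => //.
exact: chom_mV.
Qed.

Lemma retract_Tor1 X Y s : retract X Y -> Tor_zero 1 Y s -> Tor_zero 1 X s.
Proof.
move=> XY /Tor_zero1_std Y1; apply/Tor_zero1_std => x xm.
have [u [a [b [aE bE]]]] := schanuel (ses_ker (@aug_surj _ _ X))
  (ses_ker (@aug_surj _ _ Y)) (@free_projective _ _ X) (@free_projective _ _ Y) XY.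
rewrite -[x]bE; apply: chom_mV; rewrite (dsum2E (pair_chom _ _ _ _)).
apply: submodD; apply: chom_mV => //; apply: Y1.
suff : sub_incl (ker_submod (aug Y)) s (a s x) \in mV_submod (free_cmod Y) s by [].
by rewrite aE; exact: chom_mV.
Qed.

(** The exactness of the long sequence at two of its places, together with the
    invariance under retracts and the independence of the projective cover that
    the rotation relies on. They are proved simultaneously, because the proofs
    in degree [i + 1] use one another in degree [i]. *)
Record Tor_exact_at (i : nat) : Prop := TorExactAt {
  Tor_mid : forall A B X (f : chom A B) (g : chom B X) s, ses f g ->
    Tor_zero i A s -> Tor_zero i X s -> Tor_zero i B s;
  Tor_retract : forall X Y s, retract X Y -> Tor_zero i Y s -> Tor_zero i X s;
  Tor_cover : forall L P X (f : chom L P) (g : chom P X) s, ses f g ->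
    projective P -> (Tor_zero i L s <-> Tor_zero i.+1 X s);
  Tor_left : forall A B X (f : chom A B) (g : chom B X) s, ses f g ->
    Tor_zero i.+1 X s -> Tor_zero i B s -> Tor_zero i A s }.

(** By [schanuel], the kernels of two projective covers of [X] are retracts of
    each other up to a projective summand. *)
Lemma Tor_cover_of_mid i :
    (forall A B X (f : chom A B) (g : chom B X) s, ses f g ->
      Tor_zero i.+1 A s -> Tor_zero i.+1 X s -> Tor_zero i.+1 B s) ->
    (forall X Y s, retract X Y -> Tor_zero i.+1 Y s -> Tor_zero i.+1 X s) ->
  forall L P X (f : chom L P) (g : chom P X) s, ses f g ->
    projective P -> (Tor_zero i.+1 L s <-> Tor_zero i.+2 X s).
Proof.
move=> mid ret L P X f g s S Pp.
have indep L1 P1 L2 P2 (f1 : chom L1 P1) (g1 : chom P1 X) (f2 : chom L2 P2)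
    (g2 : chom P2 X) : ses f1 g1 -> ses f2 g2 -> projective P1 -> projective P2 ->
    Tor_zero i.+1 L1 s -> Tor_zero i.+1 L2 s.
  move=> S1 S2 pP1 pP2 L1z.
  have [u [a [b [_ bE]]]] := schanuel S2 S1 pP2 pP1 (retract_refl X).
  apply: (ret _ (dsum2 L1 P2)); first by exists (pair_chom a f2), b.
  by apply: (mid _ _ _ _ _ _ (ses_dsum2 L1 P2) L1z); exact: projective_Tor_zero.
have Sx := ses_ker (@aug_surj _ _ X); have Fx := @free_projective _ _ X.
split=> [Lz|/Tor_zeroSS Kz]; last exact: (indep _ _ _ _ _ _ _ _ Sx S Fx Pp Kz).
apply/Tor_zeroSS; exact: (indep _ _ _ _ _ _ _ _ S Sx Pp Fx Lz).
Qed.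

Lemma Tor_exact1 : Tor_exact_at 1.
Proof.
have cover := @Tor_cover_of_mid 0 ses_Tor1_mid retract_Tor1.
split=> // [||A B X f g s S X2 B1].
- exact: ses_Tor1_mid.
- exact: retract_Tor1.
have Sp := ses_ker (@aug_surj _ _ B).
have [L [i [j [h [Si Sj ije _]]]]] := ses_rotate Sp S.
apply: (ses_Tor1_rotate Sp Sj ije B1).
by apply/(cover _ _ _ _ _ _ Si (@free_projective _ _ B)).
Qed.

Lemma Tor_right_of_exact i A B X (f : chom A B) (g : chom B X) s :
    Tor_exact_at i.+1 -> ses f g ->
  Tor_zero i.+2 B s -> Tor_zero i.+1 A s -> Tor_zero i.+2 X s.
Proof.
move=> E S B1 A0; have Sp := ses_ker (@aug_surj _ _ B).
have [L [l [j [h [Sl Sj _ _]]]]] := ses_rotate Sp S.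
apply/(Tor_cover E _ Sl (@free_projective _ _ B)).
by apply: (Tor_mid E Sj) => //; apply/(Tor_cover E _ Sp (@free_projective _ _ B)).
Qed.

Lemma Tor_exactS i : Tor_exact_at i.+1 -> Tor_exact_at i.+2.
Proof.
move=> E.
have mid A B X (f : chom A B) (g : chom B X) s : ses f g ->
    Tor_zero i.+2 A s -> Tor_zero i.+2 X s -> Tor_zero i.+2 B s.
  move=> S A1 X1; have Sp := ses_ker (@aug_surj _ _ B).
  have [L [l [j [h [Sl Sj _ _]]]]] := ses_rotate Sp S.
  apply/(Tor_cover E _ Sp (@free_projective _ _ B)).
  by apply: (Tor_left E Sj) => //; apply/(Tor_cover E _ Sl (@free_projective _ _ B)).
have ret X Y s : retract X Y -> Tor_zero i.+2 Y s -> Tor_zero i.+2 X s.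
  move=> XY /Tor_zeroSS Y1; apply/Tor_zeroSS.
  have [u [a [b [_ bE]]]] := schanuel (ses_ker (@aug_surj _ _ X))
    (ses_ker (@aug_surj _ _ Y)) (@free_projective _ _ X) (@free_projective _ _ Y) XY.
  apply: (Tor_retract E (Y := dsum2 (syz Y 1) (free_cmod X))).
    by exists (pair_chom a (sub_incl (ker_submod (aug X)))), b.
  apply: (Tor_mid E (ses_dsum2 _ _)) => //.
  exact/projective_Tor_zero/free_projective.
have cover := Tor_cover_of_mid mid ret.
split=> // A B X f g s S X1 B1.
have Sp := ses_ker (@aug_surj _ _ B).
have [L [l [j [h [Sl Sj _ _]]]]] := ses_rotate Sp S.
apply: (Tor_right_of_exact E Sj).
  by apply/(cover _ _ _ _ _ _ Sl (@free_projective _ _ B)).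
by apply/(Tor_cover E _ Sp (@free_projective _ _ B)).
Qed.

Lemma Tor_exact i : Tor_exact_at i.+1.
Proof. by elim: i => [|i IH]; [exact: Tor_exact1 | exact: Tor_exactS]. Qed.

Lemma ses_Tor_mid i A B X (f : chom A B) (g : chom B X) s : ses f g ->
  Tor_zero i A s -> Tor_zero i X s -> Tor_zero i B s.
Proof.
by case: i => [|i] S; [exact: ses_Tor0_mid S | exact: (Tor_mid (Tor_exact i) S)].
Qed.

Lemma ses_Tor_left i A B X (f : chom A B) (g : chom B X) s : ses f g ->
  Tor_zero i.+1 X s -> Tor_zero i B s -> Tor_zero i A s.
Proof.
by case: i => [|i] S; [exact: ses_Tor0_left S | exact: (Tor_left (Tor_exact i) S)].
Qed.

Lemma ses_Tor_right i A B X (f : chom A B) (g : chom B X) s : ses f g ->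
  Tor_zero i.+1 B s -> Tor_zero i A s -> Tor_zero i.+1 X s.
Proof.
case: i => [|i] S; first exact: ses_Tor1_right S.
exact: (Tor_right_of_exact (Tor_exact i) S).
Qed.

End TorVanishing.

(** * Finite generation over a noetherian ring *)
Section FiniteLmodules.
Variable k : comPzRingType.

Lemma fg_fin (W : lmodType k) (T : finType) (x : T -> W) :
  (forall w, exists c : T -> k, w = \sum_t c t *: x t) -> fg_lmod W.
Proof.
move=> xW; exists #|T|, (fun i => x (enum_val i)) => w.
have [c ->] := xW w; exists (fun i => c (enum_val i)).
exact: (reindex _ (onW_bij _ (enum_val_bij T))).
Qed.

Lemma fg_surj (W U : lmodType k) (f : {linear W -> U}) :
  (forall u, exists w, f w = u) -> fg_lmod W -> fg_lmod U.
Proof.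
move=> fs [n [x xW]]; exists n, (fun i => f (x i)) => u.
have [w <-] := fs u; have [c ->] := xW w; exists c.
by rewrite linear_sum; apply: eq_bigr => i _; rewrite linearZ.
Qed.

Lemma fg_prod (W U : lmodType k) :
  fg_lmod W -> fg_lmod U -> fg_lmod (W * U)%type.
Proof.
move=> [n [x xW]] [m [y yU]].
pose z (t : 'I_n + 'I_m) : W * U :=
  match t with inl i => (x i, 0) | inr j => (0, y j) end.
apply: (fg_fin (x := z)) => -[w u].
have [c wE] := xW w; have [d uE] := yU u.
exists (fun t => match t with inl i => c i | inr j => d j end).
rewrite big_sumType /=.
have -> : \sum_i c i *: ((x i, 0) : W * U) = (w, 0).
  rewrite wE; elim/big_ind2: _ => // [p a q b -> ->|i _].
    by congr (_, _); rewrite /= addr0.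
  by congr (_, _); rewrite /= scaler0.
have -> : \sum_j d j *: ((0, y j) : W * U) = (0, u).
  rewrite uE; elim/big_ind2: _ => // [p a q b -> ->|i _].
    by congr (_, _); rewrite /= addr0.
  by congr (_, _); rewrite /= scaler0.
by congr (_, _); rewrite /= (addr0, add0r).
Qed.

Lemma submod_closed_sum (W : lmodType k) (N : {pred W}) (I : Type) (r : seq I)
    (c : I -> k) (x : I -> W) :
  submod_closed N -> (forall i, x i \in N) -> \sum_(i <- r) c i *: x i \in N.
Proof.
move=> [N0 NZ] xN; elim: r => [|i r IH]; first by rewrite big_nil.
by rewrite big_cons; exact: NZ.
Qed.

(** The first coefficients of the elements of [N] form an ideal, which has
    finitely many generators; after subtraction of elements of [N] that have
    these generators as coefficients, one is left with combinations of
    the other elements. *)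
Lemma fg_submod (W : lmodType k) (n : nat) (x : 'I_n -> W) (N : {pred W}) :
    noetherian k -> submod_closed N ->
    (forall w, w \in N -> exists c : 'I_n -> k, w = \sum_(i < n) c i *: x i) ->
  exists (m : nat) (y : 'I_m -> W), (forall j, y j \in N) /\
    forall w, w \in N -> exists c : 'I_m -> k, w = \sum_(j < m) c j *: y j.
Proof.
move=> kN; elim: n x N => [|n IH] x N Nc xN.
  exists 0, (fun => 0); split=> [[]//|w /xN [c ->]].
  by exists (fun => 0); rewrite !big_ord0.
have [N0 NZ] := Nc.
have NB u v : u \in N -> v \in N -> u - v \in N.
  by move=> uN vN; rewrite addrC -scaleN1r; exact: NZ.
(* the ideal of the coefficients of [x ord0] in the elements of [N] *)
pose I : {pred k} := [pred a | `[< exists2 w, w \in N &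
  exists c : 'I_n -> k, w = a *: x ord0 + \sum_(i < n) c i *: x (lift ord0 i) >]].
have Ic : submod_closed (I : {pred k^o}).
  split=> [|a b d /asboolP[u uN [c uE]] /asboolP[v vN [e vE]]]; apply/asboolP.
    exists 0 => //; exists (fun => 0); rewrite scale0r big1 ?addr0 // => i _.
    by rewrite scale0r.
  exists (a *: u + v); first exact: NZ.
  exists (fun i => a * c i + e i).
  rewrite uE vE scalerDr scalerDl scalerA addrACA scaler_sumr -big_split /=.
  by congr (_ + _); apply: eq_bigr => i _; rewrite scalerDl scalerA.
have [m [a [aI aE]]] := kN I Ic.
have /choice[u uP] : forall i, exists u, u \in N /\ exists c : 'I_n -> k,
    u = a i *: x ord0 + \sum_(j < n) c j *: x (lift ord0 j).
  by move=> i; have /asboolP[v vN [c vE]] := aI i; exists v; split=> //; exists c.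
pose N' : {pred W} := [pred w | (w \in N) && `[< exists c : 'I_n -> k,
  w = \sum_(i < n) c i *: x (lift ord0 i) >]].
have N'c : submod_closed N'.
  split=> [|b v w].
    rewrite inE N0; apply/asboolP; exists (fun => 0).
    by rewrite big1 // => i _; rewrite scale0r.
  rewrite !inE => /andP[vN /asboolP[c vE]] /andP[wN /asboolP[d wE]].
  rewrite NZ //; apply/asboolP; exists (fun i => b * c i + d i).
  rewrite {1}vE {1}wE scaler_sumr -big_split /=.
  by apply: eq_bigr => i _; rewrite scalerDl scalerA.
have [|p [y [yN' yE]]] := IH (fun i => x (lift ord0 i)) N' N'c.
  by move=> w; rewrite inE => /andP[_ /asboolP].
exists (m + p)%N, (fun i => match split i with inl i => u i | inr j => y j end).
split=> [i|w wN].
  case: (split i) => j; first exact: (uP j).1.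
  by have := yN' j; rewrite inE => /andP[].
have [c wE] := xN w wN.
have [d dE] : exists d : 'I_m -> k, c ord0 = \sum_(i < m) d i * a i.
  apply: aE; apply/asboolP; exists w => //.
  by exists (fun i => c (lift ord0 i)); rewrite wE big_ord_recl.
pose v := \sum_(i < m) d i *: u i.
have vN : v \in N by apply: submod_closed_sum => // i; exact: (uP i).1.
have [e eE] : exists e : 'I_p -> k, w - v = \sum_(j < p) e j *: y j.
  apply: yE; rewrite inE NB //; apply/asboolP.
  have /choice[f fE] := fun i => (uP i).2.
  exists (fun j => c (lift ord0 j) - \sum_(i < m) d i * f i j).
  rewrite {1}wE big_ord_recl dE /v.
  under [X in _ - X]eq_bigr do rewrite fE scalerDr scalerA scaler_sumr.
  rewrite big_split /= -scaler_suml exchange_big /=.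
  rewrite opprD addrACA subrr add0r -sumrB; apply: eq_bigr => j _.
  rewrite scalerBl scaler_suml; congr (_ - _); apply: eq_bigr => i _.
  by rewrite scalerA.
exists (fun i => match split i with inl i => d i | inr j => e j end).
rewrite big_split_ord /=.
under eq_bigr do rewrite (unsplitK (inl _)).
under [X in _ + X]eq_bigr do rewrite (unsplitK (inr _)).
by rewrite -eE addrC subrK.
Qed.

Lemma fg_inj (U W : lmodType k) (f : {linear U -> W}) :
  noetherian k -> injective f -> fg_lmod W -> fg_lmod U.
Proof.
move=> kN fi [n [x xW]].
pose N : {pred W} := [pred w | `[< exists u, f u = w >]].
have Nc : submod_closed N.
  split=> [|a _ _ /asboolP[u <-] /asboolP[v <-]]; apply/asboolP.
    by exists 0; rewrite linear0.
  by exists (a *: u + v); rewrite linearP.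
have [m [y [yN yE]]] := fg_submod kN Nc (fun w _ => xW w).
have /choice[z zE] : forall j, exists u, f u = y j by move=> j; exact/asboolP/yN.
exists m, z => u; have [|c cE] := yE (f u); first by apply/asboolP; exists u.
exists c; apply: fi; rewrite cE linear_sum; apply: eq_bigr => j _.
by rewrite linearZ zE.
Qed.

End FiniteLmodules.

(** * Generation in bounded degrees *)
Section Finiteness.
Variables (k : comPzRingType) (C : lincat k).
Implicit Types A B V W X Y L P Q : cmod C.

Definition locally_fg V : Prop := forall s, fg_lmod (V s).

(** The bound is strict, so that it is a natural number also for the zero
    module. *)
Definition gen_lt V n : Prop := forall s, (n <= s)%N -> Tor_zero 0 V s.

Lemma locally_fg_surj V W (g : chom V W) :
  surj g -> locally_fg V -> locally_fg W.
Proof. by move=> gs Vf s; apply: fg_surj (gs s) (Vf s). Qed.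

Lemma locally_fg_inj V W (f : chom V W) : noetherian k ->
  (forall s, injective (f s)) -> locally_fg W -> locally_fg V.
Proof. by move=> kN fi Wf s; exact: fg_inj kN (fi s) (Wf s). Qed.

Lemma gen_lt_full V n (N : submod V) : gen_lt V n ->
  (forall s (v : V s), (s < n)%N -> v \in N s) -> full_submod N.
Proof.
move=> Vn Nn s; elim/ltn_ind: s => s IH v; have [sn|ns] := ltnP s n; first exact: Nn.
have /Tor_zero0 /(_ v) := Vn s ns.
move: v; apply: mV_ind; [exact: submod0 | by move=> x y; exact: submodD |].
by move=> r f v rs; apply: submod_act; exact: IH.
Qed.

Lemma full_im_surj V W (f : chom V W) : full_submod (im_submod f) -> surj f.
Proof. by move=> fN s w; exact/asboolP/fN. Qed.

Inductive bounded_free (n : nat) : cmod C -> Prop :=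
| bounded_free0 P : (forall s (x : P s), x = 0) -> bounded_free n P
| bounded_freeS r P : (r < n)%N -> bounded_free n P ->
    bounded_free n (dsum2 (representable C r) P).

Lemma bounded_free_locally_fg n P : bounded_free n P -> locally_fg P.
Proof.
elim=> [{}P P0 s|r {}P _ _ IH s]; last first.
  by apply: fg_prod; [exact: hom_fg | exact: IH].
by exists 0, (fun => 0) => w; exists (fun => 0); rewrite big_ord0 (P0 _ w).
Qed.

Lemma zero_projective P : (forall s (x : P s), x = 0) -> projective P.
Proof.
move=> P0; apply: projective_retract (@free_projective _ _ P).
have Z s : linear (fun _ : P s => 0 : free_cmod P s).
  by move=> a x y; rewrite scaler0 addr0.
have Za r s (f : hom C r s) (v : P r) : 0 = act f (0 : free_cmod P r).
  by rewrite linear0.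
exists (CHom Z Za), (aug P) => s x; rewrite (P0 s x); exact: P0.
Qed.

Lemma bounded_free_Tor n P i s : bounded_free n P -> Tor_zero i.+1 P s.
Proof.
elim=> [{}P P0|r {}P _ _ IH]; first exact/projective_Tor_zero/zero_projective.
apply: (ses_Tor_mid (ses_dsum2 _ _)); last exact: IH.
exact/projective_Tor_zero/representable_projective.
Qed.

Lemma representable_gen r : gen_lt (representable C r) r.+1.
Proof.
move=> s rs; apply/Tor_zero0 => v; rewrite -[v](comp_idr v).
exact: (act_mV (V := representable C r)).
Qed.

Lemma bounded_free_gen n P : bounded_free n P -> gen_lt P n.
Proof.
elim=> [{}P P0 s _|r {}P rn _ IH s ns].
  by apply/Tor_zero0 => v; rewrite (P0 s v); exact: submod0.
apply: (ses_Tor_mid (ses_dsum2 _ _)); last exact: IH.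
by apply: representable_gen; exact: leq_trans ns.
Qed.

Lemma cover_seq V n (l : seq {r : nat & V r}) :
  (forall i, i \in l -> (tag i < n)%N) ->
  exists P (p : chom P V), bounded_free n P /\
    forall i, i \in l -> tagged i \in im_submod p (tag i).
Proof.
elim: l => [|[r v] l IH] ln.
  pose Z := sub_cmod (ker_submod (id_chom V)).
  exists Z, (sub_incl _); split=> //; apply: bounded_free0 => s x.
  by apply: val_inj; have := valP x; rewrite inE => /eqP.
have [|P [p [Pf pE]]] := IH; first by move=> i il; apply: ln; rewrite inE il orbT.
exists (dsum2 (representable C r) P), (copair (yoneda v) p); split.
  apply: bounded_freeS => //; apply: (ln (Tagged (fun r => V r) v)).
  by rewrite inE eqxx.
move=> i; rewrite inE => /orP[/eqP ->|il]; apply/asboolP.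
  exists (idm C r, 0); rewrite /= (chom0 p) addr0; exact: yoneda_id.
have /asboolP[x xE] := pE i il; exists (0, x).
by rewrite /= act0l add0r xE.
Qed.

Lemma gens_seq V n : locally_fg V ->
  exists l : seq {r : nat & V r}, (forall i, i \in l -> (tag i < n)%N) /\
    forall N : submod V, (forall i, i \in l -> tagged i \in N (tag i)) ->
      forall s (v : V s), (s < n)%N -> v \in N s.
Proof.
move=> Vf; elim: n => [|n [l [ln lN]]]; first by exists [::].
have [m [x xV]] := Vf n.
exists ([seq Tagged (fun r => V r) (x i) | i <- enum 'I_m] ++ l); split.
  by move=> i; rewrite mem_cat => /orP[/mapP[j _ ->]|/ln /ltnW] /=.
move=> N Nl s v; rewrite ltnS leq_eqVlt => /orP[/eqP sn|]; last first.
  by apply: lN => i il; apply: Nl; rewrite mem_cat il orbT.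
move: v; rewrite {}sn => v; have [c ->] := xV v.
apply: submod_closed_sum; first exact: submodP.
move=> i; apply: (Nl (Tagged (fun r => V r) (x i))).
by rewrite mem_cat; apply/orP; left; apply/mapP; exists i; rewrite ?mem_enum.
Qed.

Lemma bounded_free_cover V n : locally_fg V -> gen_lt V n ->
  exists P (p : chom P V), bounded_free n P /\ surj p.
Proof.
move=> Vf Vn; have [l [ln lN]] := gens_seq n Vf.
have [P [p [Pf pl]]] := cover_seq ln; exists P, p; split=> //.
exact/full_im_surj/(gen_lt_full Vn)/lN.
Qed.

Lemma fin_gen_gen_lt V : fin_gen V -> locally_fg V /\ exists n, gen_lt V n.
Proof.
move=> [n [d [x xV]]].
pose l := [seq Tagged (fun r => V r) (x i) | i <- enum 'I_n].
have ln i : i \in l -> (tag i < (\max_j d j).+1)%N.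
  by move=> /mapP[j _ ->] /=; rewrite ltnS; exact: leq_bigmax.
have [P [p [Pf pl]]] := cover_seq ln.
have ps : surj p.
  apply/full_im_surj/xV => i; apply: (pl (Tagged (fun r => V r) (x i))).
  by apply/mapP; exists i; rewrite ?mem_enum.
split; first exact/(locally_fg_surj ps)/(bounded_free_locally_fg Pf).
by exists (\max_j d j).+1 => s ns; apply: (surj_Tor0 ps); exact: (bounded_free_gen Pf).
Qed.

End Finiteness.

(** * Regularity and the generic shift *)
Section Regularity.
Variables (k : comPzRingType) (C : lincat k).
Implicit Types A B V W X Y L P Q : cmod C.

Definition finite_reg V : Prop :=
  exists c, forall i s, (c + i <= s)%N -> Tor_zero i V s.

Lemma finite_reg_mid A B X (f : chom A B) (g : chom B X) :
  ses f g -> finite_reg A -> finite_reg X -> finite_reg B.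
Proof.
move=> S [a Az] [c Xz]; exists (maxn a c) => i s; rewrite addn_maxl geq_max.
by move=> /andP[/Az Ais /Xz Xis]; exact: ses_Tor_mid S Ais Xis.
Qed.

Lemma zero_Tor P i s : (forall s (x : P s), x = 0) -> Tor_zero i P s.
Proof.
case: i => [|i] P0; last exact/projective_Tor_zero/zero_projective.
by apply/Tor_zero0 => v; rewrite (P0 s v); exact: submod0.
Qed.

Lemma gen_lt0_zero V : gen_lt V 0 -> forall s (x : V s), x = 0.
Proof.
move=> V0 s x.
have full : full_submod (ker_submod (id_chom V)) by exact: (gen_lt_full V0).
by apply/eqP; exact: full s x.
Qed.

(** Test the hypothesis on the submodule that is [V] in degrees [< n] and [mV]
    from there on. *)
Lemma gen_in_degrees_gen_lt V n : gen_in_degrees_le V (n%:Z - 1) -> gen_lt V n.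
Proof.
move=> Vn.
have closed s : submod_closed [pred v : V s | (s < n)%N || (v \in mV_submod V s)].
  split=> [|a u v]; first by apply/orP; right; exact: submod0.
  case/orP=> [sn _|um]; first by apply/orP; left.
  by case/orP=> [sn|vm]; apply/orP; [left | right; exact: submodZD].
have stable r s (f : hom C r s) (v : V r) :
    v \in [pred v : V r | (r < n)%N || (v \in mV_submod V r)] ->
    act f v \in [pred v : V s | (s < n)%N || (v \in mV_submod V s)].
  move=> vN; apply/orP; have [sn|ns] := ltnP s n; [by left | right].
  case/orP: vN => [rn|vm]; last exact: submod_act.
  exact/act_mV/(leq_trans rn ns).
have full := Vn (SubMod closed stable).
move=> s ns; apply/Tor_zero0 => v.
have : v \in SubMod closed stable s.
  apply: full => r; rewrite lerBrDr -PoszD lez_nat addn1 => rn w.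
  by apply/orP; left.
by case/orP => //; rewrite ltnNge ns.
Qed.

Lemma coker_Tor0P A B (f : chom A B) s : Tor_zero 0 (coker f) s <->
  forall b, exists a, b - f s a \in mV_submod B s.
Proof.
split=> [/Tor_zero0 h x|h].
  have qs : surj (quot_proj (im_submod f)).
    by move=> t y; exists (quot_repr y); exact: quot_reprK.
  have [y ym] := lift_mV qs (h (quot_proj _ s x)).
  move=> /quot_pi_eq /asboolP [v vE]; exists (- v).
  by rewrite linearN /= opprK vE addrC subrK.
apply/Tor_zero0 => z; rewrite -[z]quot_reprK.
have [v vm] := h (quot_repr z).
have : quot_proj (im_submod f) s (quot_repr z - f s v) \in mV_submod (coker f) s.
  exact: chom_mV.
rewrite chomB (_ : quot_proj (im_submod f) s (f s v) = 0) ?subr0 //.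
by apply/quot_pi_eq0; apply/asboolP; exists v.
Qed.

Section SyzygyInduction.
Variables (T : cmod C -> cmod C) (H : cmod C -> Prop).
Hypothesis k_noeth : noetherian k.
Hypothesis T_gen : forall W s, H W -> Tor_zero 0 (T W) s -> Tor_zero 0 W s.+1.
Hypothesis T_ses : forall n Z P W (f : chom Z P) (g : chom P W),
  ses f g -> bounded_free n P -> H W ->
  H Z /\ exists (f' : chom (T Z) (T P)) (g' : chom (T P) (T W)), ses f' g'.
Hypothesis T_free : forall n P j s, bounded_free n P -> (n + j <= s)%N ->
  Tor_zero j (T P) s.

(** [T] stands for [S] or [D], and [H] for the condition under which [T] keeps
    short exact sequences exact. The vanishing in homological degree zero gives
    generators of [W] in degrees [<= c]; the syzygy [Z] of a bounded free cover
    then satisfies the hypothesis again, with [c + 1] for [c]. *)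
Lemma Tor_zero_of_image i W c : locally_fg W -> H W ->
    (forall j s, (c + j <= s)%N -> Tor_zero j (T W) s) ->
  forall s, (c.+1 + i <= s)%N -> Tor_zero i W s.
Proof.
elim: i W c => [|i IH] W c Wf HW TW s.
  rewrite addn0; case: s => // s cs; apply: T_gen => //; apply: TW.
  by rewrite addn0.
move=> cs; have Wc : gen_lt W c.+1.
  by case=> // t ct; apply: T_gen => //; apply: TW; rewrite addn0.
have [P [p [Pf ps]]] := bounded_free_cover Wf Wc.
have S := ses_ker ps.
have [HZ [f' [g' S']]] := T_ses S Pf HW.
apply: (ses_Tor_right S); first exact: bounded_free_Tor Pf.
apply: (IH _ c.+1) => // [|j t ct|].
- exact: locally_fg_inj k_noeth (ses_inj S) (bounded_free_locally_fg Pf).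
- apply: (ses_Tor_left S'); last exact: T_free Pf ct.
  by apply: TW; rewrite -addSnnS.
- by rewrite addSnnS.
Qed.

Lemma finite_reg_of_image W :
  locally_fg W -> H W -> finite_reg (T W) -> finite_reg W.
Proof.
move=> Wf HW [c TW]; exists c.+1 => i s cs.
exact: Tor_zero_of_image Wf HW TW s cs.
Qed.

End SyzygyInduction.

Section GenericShift.
Variables (iota : self_embedding C).
Local Notation S := (shift iota).
Variable mu : forall V, chom V (S V).
Hypothesis k_noeth : noetherian k.
Hypothesis mu_nat : natural_to_shift mu.
Hypothesis mu_inj : forall s t, injective (mu (representable C s) t).
Hypothesis mu_gen : forall s, gen_lt (coker (mu (representable C s))) s.
Hypothesis S_free : forall i r s, (r + i < s)%N ->
  Tor_zero i (S (representable C r)) s.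

Local Notation D V := (coker (mu V)).
Definition mu_torsionfree V : Prop := forall s, injective (mu V s).

Lemma muE V W (f : chom V W) s (v : V s) :
  mu W s (f s v) = shift_map iota f s (mu V s v).
Proof. exact: mu_nat. Qed.

Lemma mV_shift V s (x : S V s) :
  x \in mV_submod (S V) s -> (x : V s.+1) \in mV_submod V s.+1.
Proof.
move: x; apply: mV_ind; [exact: submod0 | by move=> x y; exact: submodD |].
by move=> r f v rs; apply: (act_mV (V := V)).
Qed.

(** By the Yoneda lemma [mu V] is in degree [s] the action of a fixed morphism
    from [s] to [s + 1]. *)
Lemma mu_mV V s (v : V s) : (mu V s v : V s.+1) \in mV_submod V s.+1.
Proof.
have := muE (yoneda v) (idm C s : representable C s s).
by rewrite yoneda_id => ->; exact: act_mV.
Qed.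

Lemma shift_Tor0 W s : Tor_zero 0 (S W) s -> Tor_zero 0 W s.+1.
Proof. by move=> /Tor_zero0 h; apply/Tor_zero0 => v; apply: mV_shift; exact: h. Qed.

Lemma coker_Tor0 W s : Tor_zero 0 (D W) s -> Tor_zero 0 W s.+1.
Proof.
move=> /coker_Tor0P h; apply/Tor_zero0 => x; have [v /mV_shift xv] := h x.
by rewrite -[x](subrK (mu W s v : W s.+1)); apply: submodD => //; exact: mu_mV.
Qed.

Lemma ses_shift A B X (f : chom A B) (g : chom B X) :
  ses f g -> ses (shift_map iota f) (shift_map iota g).
Proof.
move=> Sfg; split=> [s|s x|s a|s b]; [exact: ses_inj Sfg s.+1|
  exact: ses_surj Sfg s.+1 x| exact: ses_comp Sfg s.+1 a|exact: ses_exact Sfg s.+1 b].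
Qed.

Lemma bounded_free_shift n P i s : bounded_free n P -> (n + i <= s)%N ->
  Tor_zero i (S P) s.
Proof.
move=> Pf ns; elim: Pf => [{}P P0|r {}P rn _ IH].
  by apply: zero_Tor => t x; exact: P0.
apply: (ses_Tor_mid (ses_shift (ses_dsum2 _ _))); last exact: IH.
by apply: S_free; apply: leq_trans ns; rewrite ltn_add2r.
Qed.

Lemma mu_torsionfree_free n P : bounded_free n P -> mu_torsionfree P.
Proof.
move=> Pf s; apply: inj_of_ker => {}s x.
elim: Pf x => [{}P P0 x _|r {}P _ _ IH x xE]; first exact: P0.
have x2 : x.2 = 0.
  by apply: IH; rewrite -[x.2]/(snd_chom _ _ s x) muE xE chom0.
move: xE; rewrite [x]dsum2E x2 chom0 addr0 muE => x1.
have m1 : mu (representable C r) s x.1 = 0.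
  apply: (ses_inj (ses_shift (ses_dsum2 (representable C r) P))).
  by rewrite chom0; exact: x1.
by rewrite (@mu_inj r s x.1 0) ?chom0 // m1.
Qed.

Lemma dsum2_coker_Tor0 A B s :
  Tor_zero 0 (D A) s -> Tor_zero 0 (D B) s -> Tor_zero 0 (D (dsum2 A B)) s.
Proof.
move=> /coker_Tor0P hA /coker_Tor0P hB; apply/coker_Tor0P => x.
have [a am] := hA x.1; have [b bm] := hB x.2.
exists (inl_chom A B s a + inr_chom A B s b).
have -> : x - mu (dsum2 A B) s (inl_chom A B s a + inr_chom A B s b) =
    shift_map iota (inl_chom A B) s (x.1 - mu A s a) +
    shift_map iota (inr_chom A B) s (x.2 - mu B s b).
  rewrite chomD !muE !chomB addrACA -opprD; congr (_ - _).
  exact: (dsum2E (x : dsum2 A B s.+1)).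
by apply: submodD; exact: chom_mV.
Qed.

Lemma bounded_free_coker_Tor0 n P s : bounded_free n P -> (n <= s.+1)%N ->
  Tor_zero 0 (D P) s.
Proof.
move=> Pf ns; elim: Pf => [{}P P0|r {}P rn _ IH].
  by apply/coker_Tor0P => x; exists 0; rewrite (P0 _ (x - _)); exact: submod0.
apply: dsum2_coker_Tor0 => //; apply: mu_gen.
by rewrite -ltnS (leq_trans rn).
Qed.

(** For [i > 0] use the sequence [P -> S P -> D P]; the gain of one degree in
    [bounded_free_coker_Tor0] is lost there. *)
Lemma bounded_free_coker n P i s : bounded_free n P -> (n + i <= s)%N ->
  Tor_zero i (D P) s.
Proof.
move=> Pf; case: i => [|i] ns.
  by apply: (bounded_free_coker_Tor0 Pf); rewrite addn0 in ns; exact: leqW.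
apply: (ses_Tor_right (ses_coker (mu_torsionfree_free Pf))).
  exact: bounded_free_shift Pf ns.
case: i ns => [|i] ns; last exact: bounded_free_Tor Pf.
by apply: (bounded_free_gen Pf); rewrite addn1 in ns; exact: ltnW.
Qed.

Lemma coker_map V W (g : chom V W) : exists h : chom (D V) (D W),
  forall s x, h s (quot_proj (im_submod (mu V)) s x) =
              quot_proj (im_submod (mu W)) s (shift_map iota g s x).
Proof.
apply: (@factor_surj _ _ _ _ _ (quot_proj (im_submod (mu V)))
  (comp_chom (quot_proj (im_submod (mu W))) (shift_map iota g))) => [s y|s x].
  by exists (quot_repr y); exact: quot_reprK.
move=> /quot_pi_eq0 /asboolP[v <-]; apply/quot_pi_eq0; apply/asboolP.
by exists (g s v); rewrite muE.
Qed.

Lemma coker_surj V W (g : chom V W) s : surj g ->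
  Tor_zero 0 (D V) s -> Tor_zero 0 (D W) s.
Proof.
move=> gs /coker_Tor0P h; apply/coker_Tor0P => x.
have [y <-] := gs s.+1 x; have [v vm] := h y.
exists (g s v); rewrite muE -[g s.+1 y]/(shift_map iota g s y) -chomB.
exact: chom_mV.
Qed.

(** This is the snake lemma: the kernel of [mu X], which is zero, is the obstruction
    to the injectivity of [D A -> D B]. *)
Lemma coker_ses A B X (f : chom A B) (g : chom B X) : ses f g ->
  mu_torsionfree X ->
  exists (f' : chom (D A) (D B)) (g' : chom (D B) (D X)), ses f' g'.
Proof.
move=> E Xt; have [f' fE] := coker_map f; have [g' gE] := coker_map g.
have qs V s (y : D V s) : exists x, quot_proj (im_submod (mu V)) s x = y.
  by exists (quot_repr y); exact: quot_reprK.
have q0 V s (x : S V s) :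
    quot_proj (im_submod (mu V)) s x = 0 <-> exists v, mu V s v = x.
  by split=> [/quot_pi_eq0 /asboolP //|h]; apply/quot_pi_eq0; apply/asboolP.
exists f', g'; split=> [|s y|s y|s y].
- apply: inj_of_ker => s y; have [x <-] := qs _ _ y.
  rewrite fE => /q0 [b bE]; apply/q0.
  have [|a aE] := @ses_exact _ _ _ _ _ _ _ E s b.
    apply: Xt; rewrite muE bE chom0; exact: (ses_comp E (s := s.+1)).
  by exists a; apply: (ses_inj (ses_shift E)); rewrite -muE aE.
- have [x <-] := qs _ _ y; have [b bE] := ses_surj E (x : X s.+1).
  by exists (quot_proj (im_submod (mu B)) s b); rewrite gE /shift_map /= bE.
- have [x <-] := qs _ _ y; rewrite fE gE; apply/q0; exists 0; rewrite chom0.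
  by apply/esym; exact: (ses_comp E (s := s.+1)).
- have [x <-] := qs _ _ y; rewrite gE => /q0 [w wE].
  have [b bE] := ses_surj E w.
  have [|a aE] := @ses_exact _ _ _ _ _ _ _ (ses_shift E) s (x - mu B s b).
    by rewrite chomB -muE bE wE subrr.
  exists (quot_proj (im_submod (mu A)) s a); rewrite fE aE chomB.
  by have /q0 -> : exists v, mu B s v = mu B s b by [exists b]; rewrite subr0.
Qed.

Lemma finite_reg_shift W : locally_fg W -> finite_reg (S W) -> finite_reg W.
Proof.
move=> Wf; apply: (finite_reg_of_image (H := fun=> True)) => //.
- by move=> V s _; exact: shift_Tor0.
- move=> n Z P V f g E _ _; split=> //.
  by exists (shift_map iota f), (shift_map iota g); exact: ses_shift.
- exact: bounded_free_shift.
Qed.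

Lemma finite_reg_coker W : locally_fg W -> mu_torsionfree W ->
  finite_reg (D W) -> finite_reg W.
Proof.
apply: (finite_reg_of_image (T := fun V => D V)) => //.
- by move=> V s _; exact: coker_Tor0.
- move=> n Z P V f g E Pf Vt; split; last exact: coker_ses E Vt.
  move=> s; apply: inj_of_ker => t z z0; apply: (ses_inj E).
  by apply: (mu_torsionfree_free Pf); rewrite muE z0 !chom0.
- exact: bounded_free_coker.
Qed.

Lemma gen_lt_coker V d : locally_fg V -> gen_lt V d.+1 -> gen_lt (D V) d.
Proof.
move=> Vf Vd s ds; have [P [p [Pf ps]]] := bounded_free_cover Vf Vd.
by apply: (coker_surj ps); exact: bounded_free_coker_Tor0 Pf _.
Qed.

Lemma gen_lt_shift V d : locally_fg V -> gen_lt V d -> gen_lt (S V) d.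
Proof.
move=> Vf Vd s ds; have [P [p [Pf ps]]] := bounded_free_cover Vf Vd.
apply: (@surj_Tor0 _ _ _ _ (shift_map iota p)); first by move=> t; exact: ps t.+1.
by apply: (bounded_free_shift Pf); rewrite addn0.
Qed.

Lemma locally_fg_shift V : locally_fg V -> locally_fg (S V).
Proof. by move=> Vf s; exact: Vf s.+1. Qed.

Lemma locally_fg_quot V (N : submod V) : locally_fg V -> locally_fg (quot_cmod N).
Proof. exact: locally_fg_surj (ses_surj (ses_quot N)). Qed.

Fixpoint mu_iter n V : chom V (iter n S V) :=
  if n is m.+1 then comp_chom (mu (iter m S V)) (mu_iter m V) else id_chom V.

Lemma locally_fg_iter n V : locally_fg V -> locally_fg (iter n S V).
Proof. by move=> Vf; elim: n => //= n; exact: locally_fg_shift. Qed.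

Lemma gen_lt_iter n V d : locally_fg V -> gen_lt V d -> gen_lt (iter n S V) d.
Proof.
by move=> Vf Vd; elim: n => //= n; apply: gen_lt_shift; exact: locally_fg_iter.
Qed.

(** The cokernel of [V -> S^n V] is a successive extension of quotients of the
    modules [D (S^j V)], all generated in degrees [< d]. *)
Lemma mu_iter_coker_gen n V d : locally_fg V -> gen_lt V d.+1 ->
  forall s (x : iter n S V s), (d <= s)%N ->
    exists v, x - mu_iter n V s v \in mV_submod (iter n S V) s.
Proof.
move=> Vf Vd s x ds; elim: n x => [|n IH] x.
  by exists x; rewrite subrr; exact: submod0.
have Yf := locally_fg_iter n Vf.
have /coker_Tor0P /(_ x) [y xy] := gen_lt_coker Yf (gen_lt_iter n Vf Vd) ds.
have [v yv] := IH y; exists v.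
have -> : x - mu_iter n.+1 V s v = (x - mu _ s y) + mu _ s (y - mu_iter n V s v).
  by rewrite chomB addrA subrK.
by apply: submodD => //; exact: chom_mV.
Qed.

Lemma mu_iterS n V s (v : V s) :
  mu_iter n V s.+1 (mu V s v) = mu_iter n.+1 V s v.
Proof. exact: esym (muE (mu_iter n V) v). Qed.

Lemma mu_iter_mono m n V s (v : V s) :
  (m <= n)%N -> mu_iter m V s v = 0 -> mu_iter n V s v = 0.
Proof.
move=> mn v0; rewrite -(subnKC mn) addnC; elim: (n - m)%N => [//|p IH].
by rewrite addSn -(chom0 (mu _) s) -IH.
Qed.

Fact torsion_closed V s :
  submod_closed [pred v : V s | `[< exists n, mu_iter n V s v = 0 >]].
Proof.
split=> [|a u v /asboolP[m um] /asboolP[n vn]]; apply/asboolP.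
  by exists 0%N; exact: chom0.
exists (maxn m n); rewrite (chom_linear (mu_iter _ V)).
rewrite (mu_iter_mono (leq_maxl m n) um) (mu_iter_mono (leq_maxr m n) vn).
by rewrite scaler0 addr0.
Qed.

Fact torsion_act V r s (f : hom C r s) (v : V r) :
  v \in [pred v : V r | `[< exists n, mu_iter n V r v = 0 >]] ->
  act f v \in [pred v : V s | `[< exists n, mu_iter n V s v = 0 >]].
Proof.
move=> /asboolP[n vn]; apply/asboolP; exists n.
by rewrite chom_act vn linear0.
Qed.

Definition torsion V : submod V := SubMod (@torsion_closed V) (@torsion_act V).

Lemma torsion_quot V : mu_torsionfree (quot_cmod (torsion V)).
Proof.
move=> s; apply: inj_of_ker => {}s x; have [v <-] := ses_surj (ses_quot (torsion V)) x.
rewrite muE => /quot_pi_eq0 /asboolP[n vn].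
apply/quot_pi_eq0; apply/asboolP; exists n.+1.
by rewrite -mu_iterS.
Qed.

(** Finitely many elements generate the torsion, and each of them is killed
    by some iterate of [mu]. *)
Lemma torsion_bounded V e : locally_fg V -> gen_lt (sub_cmod (torsion V)) e ->
  exists n, forall s (v : V s), v \in torsion V s -> mu_iter n V s v = 0.
Proof.
move=> Vf Te.
have Tf := locally_fg_inj k_noeth (ses_inj (ses_quot (torsion V))) Vf.
have [l [_ lN]] := gens_seq e Tf.
pose K n := preim_submod (sub_incl (torsion V)) (ker_submod (mu_iter n V)).
suff [n nl] : exists n, forall i, i \in l -> tagged i \in K n (tag i).
  exists n => s v vT; apply/eqP.
  exact: gen_lt_full Te (lN (K n) nl) s (exist _ v vT : sub_cmod (torsion V) s).
elim: {lN} l => [|i l [m ml]]; first by exists 0%N.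
have /asboolP[n inn] := valP (tagged i); exists (maxn m n) => j.
rewrite in_cons => /orP[/eqP ->|/ml /eqP jm]; apply/eqP.
  exact: mu_iter_mono (leq_maxr m n) inn.
exact: mu_iter_mono (leq_maxl m n) jm.
Qed.

Lemma finite_reg_gen_lt d V : locally_fg V -> gen_lt V d -> finite_reg V.
Proof.
elim: d V => [|d IH] V Vf Vd.
  by exists 0%N => i s _; exact/zero_Tor/gen_lt0_zero.
have SV := ses_quot (torsion V); set V' := quot_cmod (torsion V) in SV.
have V'f : locally_fg V' := locally_fg_quot (torsion V) Vf.
have V'd : gen_lt V' d.+1 by move=> s /Vd; exact: surj_Tor0 (ses_surj SV).
have V'r : finite_reg V'.
  apply: (finite_reg_coker V'f (@torsion_quot V)).
  apply: IH; last exact: gen_lt_coker.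
  exact/locally_fg_quot/locally_fg_shift.
(* the vanishing of [Tor_1(V')] bounds the generators of the torsion *)
have [c V'c] := V'r.
have Te : gen_lt (sub_cmod (torsion V)) (maxn c.+1 d.+1).
  move=> s; rewrite geq_max => /andP[cs /Vd]; apply: (ses_Tor_left SV).
  by apply: V'c; rewrite addn1.
have [n nT] := torsion_bounded Vf Te.
have [||h hE] := @factor_surj _ _ _ _ _ (quot_proj (torsion V)) (mu_iter n V).
- exact: ses_surj SV.
- by move=> s v /quot_pi_eq0 /nT.
have hi s : injective (h s).
  apply: inj_of_ker => {}s x; have [v <-] := ses_surj SV x; rewrite hE => v0.
  by apply/quot_pi_eq0; apply/asboolP; exists n.
(* [V'] embeds in [S^n V] with a cokernel generated in lower degrees *)
have Wr : finite_reg (iter n S V).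
  apply: (finite_reg_mid (ses_coker hi) V'r); apply: IH.
    exact/locally_fg_quot/locally_fg_iter.
  move=> s ds; apply/coker_Tor0P => x.
  have [v xv] := mu_iter_coker_gen Vf Vd x ds.
  by exists (quot_proj (torsion V) s v); rewrite hE.
elim: {nT h hE hi} n Wr => [//|n IHn] Wr; apply: IHn.
exact: finite_reg_shift (locally_fg_iter n Vf) Wr.
Qed.

End GenericShift.

(** * Suprema of extended integers *)

Local Open Scope ereal_scope.

Lemma supremum_le d (T : orderType d) (x0 u : T) (A : set T) :
  (x0 <= u)%O -> (forall t, A t -> (t <= u)%O) -> (supremum x0 A <= u)%O.
Proof.
move=> x0u Au; rewrite /supremum; case: ifP => // _.
case: xgetP => // y _ [_]; exact.
Qed.

(** [supremum] is a default value on a set that has no least upper bound, so the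
    existence is needed before a bound on the regularity says anything about
    the homology. *)
Lemma ereal_int_supremum (A : set (\bar int)) : (supremums A !=set0)%classic.
Proof.
have [[n nA]|noub] := pselect (exists n : int, forall t, A t -> t <= n%:E); last first.
  exists +oo; split=> [t _|u uA]; first exact: leey.
  case: u uA => [n| |] uA; [by case: noub; exists n| exact: lexx|].
  by case: noub; exists 0%R => t /uA /le_trans -> //; exact: leNye.
have [Aoo|] := pselect (forall t, A t -> t <= -oo).
  by exists -oo; split=> // u _; exact: leNye.
move=> /existsNP[t /not_implyP[At tNoo]].
case: t At tNoo => [m| |] At tNoo; last by case: tNoo.
- have mn : (m <= n)%R by have := nA _ At; rewrite lee_fin.
  have ex : exists j : nat, `[< forall t, A t -> t <= (m + j%:Z)%:E >].
    exists `|n - m|%N; apply/asboolP => t At'.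
    by rewrite gez0_abs ?subr_ge0 // (addrC m) subrK; exact: nA.
  case: (ex_minnP ex) => j /asboolP jA jmin.
  exists (m + j%:Z)%:E; split=> [t /jA //|u uA].
  case: u uA (uA _ At) => [p| |] uA // mp; last exact: leey.
  rewrite lee_fin in mp.
  have : (j <= `|p - m|)%N.
    apply: jmin; apply/asboolP => t At'.
    by rewrite gez0_abs ?subr_ge0 // (addrC m) subrK; exact: uA.
  by rewrite -lez_nat gez0_abs ?subr_ge0 // lerBrDl lee_fin.
- by have := nA _ At; rewrite leye_eq.
Qed.

Lemma reg_le_Tor V (r : nat) : reg V <= r%:Z%:E ->
  forall i s, (r + i < s)%N -> Tor_zero i V s.
Proof.
move=> Vr i s ris; constructor=> x; apply/eqP/negPn/negP => x0.
have s_hd : s%:Z%:E <= hd i V.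
  apply: ge_supremum_Nmem; first exact: ereal_int_supremum.
  by exists s => //; exists x.
have hd_reg : hd i V - i%:Z%:E <= reg V.
  apply: ge_supremum_Nmem; first exact: ereal_int_supremum.
  by exists i.
have := le_trans (le_trans (leeB s_hd (lexx (i%:Z%:E))) hd_reg) Vr.
by rewrite -EFinB lee_fin lerBlDr -PoszD lez_nat leqNgt ris.
Qed.

Lemma finite_reg_lt V : finite_reg V -> reg V < +oo.
Proof.
move=> [c Vc]; apply: (@le_lt_trans _ _ (c%:Z%:E)); last exact: ltry.
apply: supremum_le => [|_ [i _ <-]]; first exact: leNye.
have hd_le : hd i V <= (c + i)%N%:Z%:E.
  apply: supremum_le => [|_ [s [x x0] <-]]; first by rewrite lee_fin.
  rewrite lee_fin lez_nat leqNgt; apply/negP => /ltnW /Vc [h].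
  by rewrite (h x) eqxx in x0.
apply: le_trans (leeB hd_le (lexx (i%:Z%:E))) _.
by rewrite -(EFinB (c + i)%N%:Z i%:Z) lee_fin (PoszD c i) addrK.
Qed.

End Regularity.

Theorem corollary1p11 (k : comPzRingType) (k_noeth : noetherian k)
    (C : lincat k) (iota : self_embedding C) (S_generic : generic_shift iota)
    (reg_SM : forall s : nat,
      (reg (shift iota (representable C s)) <= s%:Z%:E)%E)
    (V : cmod C) (V_fg : fin_gen V) :
  (reg V < +oo)%E.
Proof.
have [mu [mu_nat mu_generic]] := S_generic.
have [Vf [d Vd]] := fin_gen_gen_lt V_fg.
apply: finite_reg_lt; apply: (finite_reg_gen_lt k_noeth mu_nat _ _ _ Vf Vd).
- by move=> s t; exact: (mu_generic s).1.
- by move=> s; exact: gen_in_degrees_gen_lt (mu_generic s).2.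
- by move=> i r s; exact: reg_le_Tor (reg_SM r) i s.
Qed.
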